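(* Let $Q\in\mathbb{R}^{n\times m}_+$ be a column-stochastic matrix (a classical channel with $m$ inputs and $n$ outputs), let $\mathcal{N}\in\Phi(\mathcal{H}_A,\mathcal{H}_B)$ be a quantum channel, and let $\mathcal{E}\in\Phi(\mathcal{H}_X,\mathcal{H}_A)$ be an encoding channel, where $\mathcal{H}_X\cong\mathbb{C}^m$ has orthonormal basis $\{|j\rangle\}$ and $\rho_j=\mathcal{E}(|j\rangle\langle j|)$. Then: (a) $-I_c$ is $\zeta_Q$-smooth and $\eta_Q$-strongly convex relative to the negative Shannon entropy $-H$ on $\Delta_m$, where $I_c(p)=\sum_{j=1}^m\sum_{i=1}^n p_jQ_{ij}\log\big(Q_{ij}/\sum_{k=1}^m p_kQ_{ik}\big)$; (b) $-\chi$ is $\zeta_{\mathcal{N}\circ\mathcal{E}}$-smooth and $\eta_{\mathcal{N}\circ\mathcal{E}}$-strongly convex relative to $-H$ on $\Delta_m$, where $\chi(p)=S\big(\mathcal{N}(\sum_{j}p_j\rho_j)\big)-\sum_j p_jS(\mathcal{N}(\rho_j))$; (c) $-I_q$ is $(1+\zeta_{\mathcal{N}}-\eta_{\mathcal{N}_c})$-smooth and $(1+\eta_{\mathcal{N}}-\zeta_{\mathcal{N}_c})$-strongly convex relative to the negative von Neumann entropy $-S$ on $\mathcal{D}(\mathcal{H}_A)$, where $I_q(\rho)=S(\rho)+S(\mathcal{N}(\rho))-S(\mathcal{N}_c(\rho))$.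
   Context: $\Delta_m$ is the probability simplex in $\mathbb{R}^m$; $H(x)=-\sum_i x_i\log x_i$, $H(x\|y)=\sum_i x_i\log(x_i/y_i)$; $\mathcal{D}(\mathcal{H})$ is the set of density matrices; $S(\rho)=-\operatorname{tr}[\rho\log\rho]$, $S(\rho\|\sigma)=\operatorname{tr}[\rho(\log\rho-\log\sigma)]$. $\Phi(\mathcal{H}_A,\mathcal{H}_B)$ denotes completely positive trace-preserving maps. If $\mathcal{N}(\rho)=\operatorname{tr}_E(U\rho U^\dagger)$ is a Stinespring representation with isometry $U:\mathcal{H}_A\to\mathcal{H}_B\otimes\mathcal{H}_E$, the complementary channel is $\mathcal{N}_c(\rho)=\operatorname{tr}_B(U\rho U^\dagger)$. Channel coefficients: $\zeta_Q=\sup\{H(Qp\|Qq)/H(p\|q):p,q\in\Delta_m,p\ne q\}$, $\eta_Q=\inf\{\cdot\}$ of the same ratio; for a quantum channel $\mathcal{M}\in\Phi(\mathcal{H},\mathcal{H}')$, $\zeta_{\mathcal{M}}=\sup\{S(\mathcal{M}(\rho)\|\mathcal{M}(\sigma))/S(\rho\|\sigma):\rho,\sigma\in\mathcal{D}(\mathcal{H}),\rho\ne\sigma\}$ and $\eta_{\mathcal{M}}$ is the corresponding infimum. A function $f$ is $L$-smooth (resp. $\mu$-strongly convex) relative to a Legendre function $\varphi$ on a convex set $\mathcal{C}$ if $L\varphi-f$ (resp. $f-\mu\varphi$) is convex on the relative interior of $\mathcal{C}$. *)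

(* Defs.v *)
From Stdlib Require Import ClassicalEpsilon.
From mathcomp Require Import all_boot all_order all_algebra.
From mathcomp Require Import all_classical all_reals all_analysis.
From mathcomp Require Import complex mxtens.
Import Order.TTheory GRing.Theory Num.Theory.

Set Implicit Arguments.
Unset Strict Implicit.
Unset Printing Implicit Defensive.

Local Open Scope ring_scope.

Section Defs.
Variable R : realType.
Local Notation C := R[i].

(* [comb t x y] is the convex combination t x + (1-t) y.               *)

Definition convex_on {T : Type} (comb : R -> T -> T -> T) (S : T -> Prop)
  (g : T -> R) : Prop :=
  forall x y t, S x -> S y -> 0 <= t -> t <= 1 ->
    g (comb t x y) <= t * g x + (1 - t) * g y.

(* relative interior of a convex set S (Rockafellar, Thm 6.4):
   x in ri S iff for every y in S, x can be pushed slightly beyond itself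
   away from y while staying in S. *)
Definition relint {T : Type} (comb : R -> T -> T -> T) (S : T -> Prop)
  (x : T) : Prop :=
  S x /\ forall y, S y -> exists mu : R, 1 < mu /\ S (comb mu x y).

Definition rel_smooth {T : Type} (comb : R -> T -> T -> T) (S : T -> Prop)
  (f phi : T -> R) (L : R) : Prop :=
  convex_on comb (relint comb S) (fun x => L * phi x - f x).

Definition rel_strongly_convex {T : Type} (comb : R -> T -> T -> T)
  (S : T -> Prop) (f phi : T -> R) (mu : R) : Prop :=
  convex_on comb (relint comb S) (fun x => f x - mu * phi x).

Definition prob_vec (m : nat) (p : 'cV[R]_m) : Prop :=
  (forall j, 0 <= p j 0) /\ \sum_j p j 0 = 1.

Definition comb_cl (m : nat) (t : R) (p q : 'cV[R]_m) : 'cV[R]_m :=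
  t *: p + (1 - t) *: q.

Definition col_stochastic (n m : nat) (Q : 'M[R]_(n, m)) : Prop :=
  (forall i j, 0 <= Q i j) /\ (forall j, \sum_i Q i j = 1).

(* Shannon entropy; note ln 0 = 0 in mathcomp-analysis, so 0 ln 0 = 0 *)
Definition shannon (m : nat) (p : 'cV[R]_m) : R :=
  - \sum_i p i 0 * ln (p i 0).

(* relative entropy H(p||q) = sum_i p_i log (p_i/q_i) (0 log 0 = 0) *)
Definition rel_ent_cl (m : nat) (p q : 'cV[R]_m) : R :=
  \sum_i p i 0 * (ln (p i 0) - ln (q i 0)).

(* supp p included in supp q, i.e. H(p||q) < +oo *)
Definition supp_incl_cl (m : nat) (p q : 'cV[R]_m) : Prop :=
  forall i, p i 0 != 0 -> q i 0 != 0.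

Definition ratio_set_cl (n m : nat) (Q : 'M[R]_(n, m)) : set R :=
  [set r | exists p q : 'cV[R]_m, [/\ prob_vec p, prob_vec q, p != q,
      supp_incl_cl p q & r = rel_ent_cl (Q *m p) (Q *m q) / rel_ent_cl p q]].

Definition zeta_cl (n m : nat) (Q : 'M[R]_(n, m)) : R := sup (ratio_set_cl Q).
Definition eta_cl (n m : nat) (Q : 'M[R]_(n, m)) : R := inf (ratio_set_cl Q).

Definition I_c (n m : nat) (Q : 'M[R]_(n, m)) (p : 'cV[R]_m) : R :=
  \sum_j \sum_i p j 0 * Q i j * ln (Q i j / \sum_k p k 0 * Q i k).

Definition embC (x : R) : C := (x%:C)%C.

Definition mx_adj (p q : nat) (A : 'M[C]_(p, q)) : 'M[C]_(q, p) :=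
  map_mx Num.conj A^T.

Definition is_psd (d : nat) (A : 'M[C]_d) : Prop :=
  forall v : 'cV[C]_d, 0 <= (mx_adj v *m A *m v) 0 0.

Definition is_density (d : nat) (rho : 'M[C]_d) : Prop :=
  is_psd rho /\ \tr rho = 1.

Definition comb_q (d : nat) (t : R) (X Y : 'M[C]_d) : 'M[C]_d :=
  embC t *: X + embC (1 - t) *: Y.

Definition is_unitary (d : nat) (U : 'M[C]_d) : Prop := U *m mx_adj U = 1%:M.

Definition is_isometry (p q : nat) (V : 'M[C]_(p, q)) : Prop := mx_adj V *m V = 1%:M.

Definition is_spectral (d : nat) (A : 'M[C]_d) (U : 'M[C]_d) (l : 'rV[R]_d) : Prop :=
  is_unitary U /\ A = U *m diag_mx (map_mx embC l) *m mx_adj U.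

Definition spec_pair (d : nat) (A : 'M[C]_d) : 'M[C]_d * 'rV[R]_d :=
  epsilon (inhabits (1%:M, 0)) (fun P => is_spectral A P.1 P.2).

(* functional calculus f(A) for Hermitian A, through a chosen is_spectral
   decomposition (well defined by uniqueness of the is_spectral calculus) *)
Definition mxfun (d : nat) (f : R -> R) (A : 'M[C]_d) : 'M[C]_d :=
  (spec_pair A).1 *m diag_mx (map_mx (fun x => embC (f x)) (spec_pair A).2)
    *m mx_adj (spec_pair A).1.

(* log A; on the kernel of A the value ln 0 = 0 is used *)
Definition mxlog (d : nat) (A : 'M[C]_d) : 'M[C]_d := mxfun (@ln R) A.

Definition vN_entropy (d : nat) (rho : 'M[C]_d) : R :=
  - complex.Re (\tr (rho *m mxlog rho)).

Definition rel_ent_q (d : nat) (rho sigma : 'M[C]_d) : R :=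
  complex.Re (\tr (rho *m (mxlog rho - mxlog sigma))).

(* supp rho included in supp sigma (i.e. S(rho||sigma) < +oo) *)
Definition supp_incl_q (d : nat) (rho sigma : 'M[C]_d) : Prop :=
  forall v : 'cV[C]_d, sigma *m v = 0 -> rho *m v = 0.

Definition ratio_set_q (a b : nat) (M : 'M[C]_a -> 'M[C]_b) : set R :=
  [set r | exists rho sigma : 'M[C]_a, [/\ is_density rho, is_density sigma,
      rho != sigma, supp_incl_q rho sigma &
      r = rel_ent_q (M rho) (M sigma) / rel_ent_q rho sigma]].

Definition zeta_q (a b : nat) (M : 'M[C]_a -> 'M[C]_b) : R := sup (ratio_set_q M).
Definition eta_q (a b : nat) (M : 'M[C]_a -> 'M[C]_b) : R := inf (ratio_set_q M).

(* Kronecker index pairing: (i, x) |-> i * n + x in 'I_(m * n) *)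
(* ampliation id_k (x) Phi acting on 'M_(k * a) *)
Definition ampl (k a b : nat) (Phi : 'M[C]_a -> 'M[C]_b) (P : 'M[C]_(k * a))
  : 'M[C]_(k * b) :=
  \matrix_(r, s)
    let ix := mxtens_unindex r in let jy := mxtens_unindex s in
    Phi (\matrix_(x, y) P (mxtens_index (ix.1, x)) (mxtens_index (jy.1, y)))
      ix.2 jy.2.

Definition is_linear_map (a b : nat) (Phi : 'M[C]_a -> 'M[C]_b) : Prop :=
  forall (c : C) (X Y : 'M[C]_a), Phi (c *: X + Y) = c *: Phi X + Phi Y.

Definition trace_preserving (a b : nat) (Phi : 'M[C]_a -> 'M[C]_b) : Prop :=
  forall X, \tr (Phi X) = \tr X.

Definition completely_positive (a b : nat) (Phi : 'M[C]_a -> 'M[C]_b) : Prop :=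
  forall (k : nat) (P : 'M[C]_(k * a)), is_psd P -> is_psd (ampl Phi P).

Definition cptp (a b : nat) (Phi : 'M[C]_a -> 'M[C]_b) : Prop :=
  [/\ is_linear_map Phi, trace_preserving Phi & completely_positive Phi].

(* partial traces on 'M_(b * e) ~ B(H_B (x) H_E) *)
Definition ptrace_E (b e : nat) (M : 'M[C]_(b * e)) : 'M[C]_b :=
  \matrix_(i, j) \sum_(k < e) M (mxtens_index (i, k)) (mxtens_index (j, k)).

Definition ptrace_B (b e : nat) (M : 'M[C]_(b * e)) : 'M[C]_e :=
  \matrix_(i, j) \sum_(k < b) M (mxtens_index (k, i)) (mxtens_index (k, j)).

(* complementary channel associated with the Stinespring is_isometry V *)
Definition compl_channel (a b e : nat) (V : 'M[C]_(b * e, a)) (X : 'M[C]_a)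
  : 'M[C]_e := ptrace_B (V *m X *m mx_adj V).

Definition ketbra (m : nat) (j : 'I_m) : 'M[C]_m := delta_mx j j.

Definition holevo (m a b : nat) (N : 'M[C]_a -> 'M[C]_b)
  (E : 'M[C]_m -> 'M[C]_a) (p : 'cV[R]_m) : R :=
  vN_entropy (N (\sum_j embC (p j 0) *: E (ketbra j)))
  - \sum_j p j 0 * vN_entropy (N (E (ketbra j))).

Definition I_q (a b e : nat) (N : 'M[C]_a -> 'M[C]_b) (Nc : 'M[C]_a -> 'M[C]_e)
  (rho : 'M[C]_a) : R :=
  vN_entropy rho + vN_entropy (N rho) - vN_entropy (Nc rho).

End Defs.

(* Main.v *)
(* Write D for relative entropy and, for z = t x + (1-t) y, let the Jensen gap of f be
   t f(x) + (1-t) f(y) - f(z). The gap of a negative entropy at (x, y) is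
   t D(x||z) + (1-t) D(y||z), and, up to affine terms, -I_c, -chi and -I_q are sums and
   differences of negative entropies of channel outputs. Comparing gaps termwise gives
   every claim as soon as eta D <= D(M x||M z) <= zeta D. Since [sup] and [inf] are junk
   on unbounded sets, this needs the ratio sets to be bounded, i.e. 0 <= D and data
   processing.

   Quantum data processing: in eigenbases of rho (eigenvalues p) and sigma (eigenvalues q)
   with overlaps c_ij = |V_ij|^2, put F(s) = sum c_ij p_i (ln (q_j + s p_i) - ln p_i).
   Then F(0) = - D(rho||sigma), F(s) - ln s -> 0 at +oo, and F'(s) is the maximum over Y of
   2 Re tr(Y rho) - tr(sigma Y Y^H) - s tr(rho Y^H Y). Pulling the optimal Y of the output
   states back by the adjoint channel, the Kadison-Schwarz inequality shows that F'
   decreases under the channel, hence so does D. *)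

From Stdlib Require Import ClassicalEpsilon.
Require Import Defs.
From mathcomp Require Import all_boot all_order all_algebra.
From mathcomp Require Import all_classical all_reals all_analysis.
From mathcomp Require Import complex mxtens.
From mathcomp Require Import ring lra.
Import Order.TTheory GRing.Theory Num.Theory.
Import numFieldNormedType.Exports.
Local Open Scope ring_scope.

Set Implicit Arguments.
Unset Strict Implicit.
Unset Printing Implicit Defensive.

(* MathComp's [is_unitary] (on hermitian forms) shadows the one of [Defs]. *)
Local Notation is_unitary := Defs.is_unitary.
Local Notation "A ^H" := (mx_adj A) (at level 8, format "A ^H").

(** * Logarithmic sums *)

(** This is [ln (1 + x) <= x] at [x = b / a - 1], multiplied by [- a]. The support condition
    excludes [b = 0 < a], where the default value [ln 0 = 0] can make the inequality false. *)
Lemma sub_le_mul_ln (R : realType) (a b : R) : 0 <= a -> 0 <= b ->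
  (a != 0 -> b != 0) -> a - b <= a * (ln a - ln b).
Proof.
move=> a0 b0 ab; have [->|aN0] := eqVneq a 0; first by rewrite mul0r sub0r oppr_le0.
have {}a0 : 0 < a by rewrite lt0r aN0.
have {}b0 : 0 < b by rewrite lt0r ab.
have ba0 : 0 < b / a by rewrite divr_gt0.
have := @le_ln1Dx R (b / a - 1); rewrite subrKC ltrBrDl addrN => /(_ ba0).
rewrite ln_div // => h.
have -> : a - b = a * - (b / a - 1) by field; rewrite gt_eqF.
by rewrite ler_pM2l //; lra.
Qed.

Lemma is_derive_big (R : realType) (I : Type) (r : seq I) (h : I -> R -> R)
  (dh : I -> R) (x : R) : (forall i, is_derive x 1 (h i) (dh i)) ->
  is_derive x 1 (fun y => \sum_(i <- r) h i y) (\sum_(i <- r) dh i).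
Proof.
move=> dhE; elim: r => [|i r IH].
  rewrite big_nil (_ : (fun _ => _) = cst 0); first exact: is_derive_cst.
  by apply/funext => y; rewrite big_nil.
rewrite big_cons (_ : (fun _ => _) = h i \+ (fun y => \sum_(j <- r) h j y)).
  exact: is_deriveD.
by apply/funext => y; rewrite big_cons.
Qed.

(** The function F of the overview, with pairs of eigenvalue indices as [I] and the factor c_ij p_i
    absorbed into the weight [w]. *)
Definition log_shift (R : realType) (I : finType) (w p q : I -> R) (s : R) : R :=
  \sum_i w i * (ln (q i + s * p i) - ln (p i)).

(** Positivity is required only where the weight is nonzero; this is the form that support inclusion
    takes in an eigenbasis. *)
Definition pos_supp (R : realType) (I : finType) (w p q : I -> R) : Prop :=
  forall i, 0 <= w i /\ (w i != 0 -> 0 < p i /\ 0 < q i).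

Lemma is_derive_log_shift (R : realType) (I : finType) (w p q : I -> R) (s : R) :
  pos_supp w p q -> 0 <= s ->
  is_derive s 1 (log_shift w p q) (\sum_i w i * (p i / (q i + s * p i))).
Proof.
move=> wpq s0; apply: is_derive_big => i.
have [wi0|wiN0] := eqVneq (w i) 0.
  rewrite wi0 mul0r (_ : (fun _ => _) = cst 0); first exact: is_derive_cst.
  by apply/funext => y; rewrite mul0r.
have [_ /(_ wiN0)[pi qi]] := wpq i.
have y0 : 0 < q i + s * p i by rewrite ltr_pwDl // mulr_ge0 // ltW.
have h1 : is_derive s 1 (fun y : R => q i + y * p i) (p i).
  have h0 : is_derive s 1 (cst (q i) + ( p i \*: (@id R))) (0 + p i *: 1).
    exact: is_deriveD.
  rewrite add0r /GRing.scale/= mulr1 in h0.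
  by rewrite (_ : (fun _ => _) = cst (q i) + p i \*: id) //; apply/funext => y /=;
    rewrite /GRing.scale/= mulrC.
have h2 : is_derive s 1 (@ln R \o (fun y : R => q i + y * p i))
    (p i * (q i + s * p i)^-1).
  by rewrite mulrC; apply: is_derive1_comp; exact: is_derive1_ln.
have h3 : is_derive s 1 ((w i) \*: ((@ln R \o (fun y : R => q i + y * p i)) - cst (ln (p i))))
   (w i *: (p i * (q i + s * p i)^-1 - 0)).
  by apply: is_deriveZ; apply: is_deriveB.
by rewrite subr0 in h3.
Qed.

(** Factor [q + s p = s p (1 + q / (p s))] and apply [ln (1 + x) <= x]. The shift thus behaves like
    [ln s] at infinity, with an error of order [1 / s], whatever the states are. *)
Lemma log_shift_bounds (R : realType) (I : finType) (w p q : I -> R) (s : R) :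
  pos_supp w p q -> \sum_i w i = 1 -> 0 < s ->
  ln s <= log_shift w p q s <= ln s + (\sum_i w i * (q i / p i)) / s.
Proof.
move=> wpq w1 s0.
have -> : ln s = \sum_i w i * ln s by rewrite -big_distrl /= w1 mul1r.
rewrite mulr_suml -big_split /=; apply/andP; split; apply: ler_sum => i _.
all: have [w0 wN0] := wpq i; have [->|/wN0 [pi qi]] := eqVneq (w i) 0;
  rewrite ?mul0r ?addr0 // -?mulrA -?mulrDr ler_wpM2l //.
  rewrite lerBrDr -lnM ?posrE // ler_ln ?posrE ?mulr_gt0 //.
    by rewrite lerDr ltW.
  by rewrite ltr_pwDl // mulr_ge0 // ltW.
have -> : q i + s * p i = (s * p i) * (1 + q i / p i / s).
  by field; rewrite !gt_eqF.
have h : 0 <= q i / p i / s by rewrite !divr_ge0 // ltW.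
have h1 : 0 < 1 + q i / p i / s by rewrite ltr_pwDl.
rewrite !lnM ?posrE ?mulr_gt0 //.
have := @le_ln1Dx R _ (lt_le_trans (ltrN10 _) h); rewrite !mulrA; lra.
Qed.

(* [- log_shift 0] is the relative entropy, while its derivative in the shift is
   the quantity which is monotone; the two entropies are compared at [s = +oo]. *)
Lemma log_shift_compare (R : realType) (I J : finType) (w p q : I -> R)
  (w' p' q' : J -> R) :
  pos_supp w p q -> pos_supp w' p' q' ->
  \sum_i w i = 1 -> \sum_j w' j = 1 ->
  (forall s, 0 < s -> \sum_j w' j * (p' j / (q' j + s * p' j))
     <= \sum_i w i * (p i / (q i + s * p i))) ->
  \sum_j w' j * (ln (p' j) - ln (q' j)) <= \sum_i w i * (ln (p i) - ln (q i)).
Proof.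
move=> wpq wpq' w1 w1' dle.
pose G := log_shift w p q - log_shift w' p' q'.
have dG (s : R) : 0 <= s -> is_derive s 1 G
  (\sum_i w i * (p i / (q i + s * p i)) - \sum_j w' j * (p' j / (q' j + s * p' j))).
  by move=> s0; apply: is_deriveB; apply: is_derive_log_shift.
have Gle (s : R) : 0 < s -> G 0 <= G s.
  move=> s0.
  have cG : {within `[0, s], continuous G}%classic.
    apply: derivable_within_continuous => x; rewrite in_itv /= => /andP[x0 _].
    by apply: ex_derive; exact: dG.
  have := @ger0_derive1_le_cc R G 0 s _ _ cG; apply => //.
  - by move=> x; rewrite in_itv /= => /andP[/ltW x0 _]; apply: ex_derive; exact: dG.
  - move=> x; rewrite in_itv /= => /andP[x0 _].
    by rewrite derive1E (@derive_val _ _ _ _ _ _ _ (dG x (ltW x0))) subr_ge0 dle.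
  - by rewrite in_itv /= lexx ltW.
  - by rewrite in_itv /= lexx ltW.
  - exact: ltW.
set K := \sum_i w i * (q i / p i).
have K0 : 0 <= K.
  apply: sumr_ge0 => i _; have [w0 wN0] := wpq i.
  have [->|/wN0 [pi qi]] := eqVneq (w i) 0; first by rewrite mul0r.
  by rewrite mulr_ge0 // divr_ge0 // ltW.
have G0 : G 0 <= 0.
  rewrite leNgt; apply/negP => G0.
  (* At this [s], [K / s = G 0 * K / (K + 1) < G 0], which contradicts [G 0 <= G s <= K / s]. Taking
     [K + 1] keeps [s] positive when [K = 0]. *)
  pose s := (K + 1) / G 0.
  have s0 : 0 < s by rewrite divr_gt0 // ltr_wpDl.
  have /andP[_ h1] := log_shift_bounds wpq w1 s0.
  have /andP[h2 _] := log_shift_bounds wpq' w1' s0.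
  have : G 0 <= K / s.
    apply: (le_trans (Gle s s0)).
    rewrite -[X in X <= _]/(log_shift w p q s - log_shift w' p' q' s).
    rewrite -/K in h1; lra.
  rewrite leNgt => /negP; apply; rewrite /s invf_div mulrCA gtr_pMr //.
  by rewrite ltr_pdivrMr ?mul1r ?ltrDl // ltr_wpDl.
have opp0 (A : finType) (v x y : A -> R) :
  \sum_j v j * (ln (x j) - ln (y j)) = - log_shift v x y 0.
  rewrite /log_shift -sumrN; apply: eq_bigr => i _.
  by rewrite mul0r addr0 -mulrN opprB.
rewrite !opp0; move: G0; rewrite -[G 0]/(log_shift w p q 0 - log_shift w' p' q' 0); lra.
Qed.

(** * Adjoints of complex matrices *)

Section Adjoint.
Variable R : realType.
Local Notation C := R[i].
Implicit Types (p q r : nat).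

Lemma mx_adjE p q (A : 'M[C]_(p, q)) i j : A^H i j = conjc (A j i).
Proof. by rewrite !mxE. Qed.

Lemma mx_adjK p q (A : 'M[C]_(p, q)) : A^H^H = A.
Proof. by apply/matrixP => i j; rewrite !mx_adjE conjcK. Qed.

Lemma mx_adjM p q r (A : 'M[C]_(p, q)) (B : 'M[C]_(q, r)) :
  (A *m B)^H = B^H *m A^H.
Proof. by rewrite /mx_adj trmx_mul map_mxM. Qed.

Lemma mx_adjD p q (A B : 'M[C]_(p, q)) : (A + B)^H = A^H + B^H.
Proof. by apply/matrixP => i j; rewrite !(mx_adjE, mxE) rmorphD. Qed.

Lemma mx_adjZ p q (c : C) (A : 'M[C]_(p, q)) : (c *: A)^H = conjc c *: A^H.
Proof. by apply/matrixP => i j; rewrite !(mx_adjE, mxE) rmorphM. Qed.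

Lemma mx_adj0 p q : (0 : 'M[C]_(p, q))^H = 0.
Proof. by apply/matrixP => i j; rewrite !(mx_adjE, mxE) rmorph0. Qed.

Lemma mx_adj1 p : (1%:M : 'M[C]_p)^H = 1%:M.
Proof. by apply/matrixP => i j; rewrite !(mx_adjE, mxE) eq_sym rmorph_nat. Qed.

Lemma mx_adj_delta p q i j : (delta_mx i j : 'M[C]_(p, q))^H = delta_mx j i.
Proof. by apply/matrixP => k l; rewrite !(mx_adjE, mxE) andbC rmorph_nat. Qed.

Lemma mxtrace_adj p (A : 'M[C]_p) : \tr A^H = conjc (\tr A).
Proof.
by rewrite /mxtrace rmorph_sum; apply: eq_bigr => i _; rewrite mx_adjE.
Qed.

Lemma Re_sum (I : Type) (r : seq I) (P : pred I) (F : I -> C) :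
  complex.Re (\sum_(i <- r | P i) F i) = \sum_(i <- r | P i) complex.Re (F i).
Proof. by apply: big_morph => // -[a b] [c d]. Qed.

(** The squared modulus as an element of [R], so that it can serve as a weight in real sums. *)
Definition sqmod (z : C) : R := complex.Re z ^+ 2 + complex.Im z ^+ 2.

Lemma mul_conjc (z : C) : z * conjc z = embC (sqmod z).
Proof.
case: z => a b; apply/eqP; rewrite eq_complex /= /sqmod /=.
by apply/andP; split; apply/eqP; ring.
Qed.

Lemma sqmod_ge0 z : 0 <= sqmod z.
Proof. by rewrite addr_ge0 // sqr_ge0. Qed.

Lemma sqmod_eq0 z : sqmod z = 0 -> z = 0.
Proof.
move/eqP; rewrite paddr_eq0 ?sqr_ge0 // !sqrf_eq0 => /andP[/eqP a /eqP b].
by apply/eqP; rewrite eq_complex a b !eqxx.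
Qed.

Lemma Re_embC (x : R) : complex.Re (embC x) = x. Proof. by []. Qed.

Lemma Re_mulr_embC (z : C) (x : R) : complex.Re (z * embC x) = complex.Re z * x.
Proof. by case: z => a b /=; ring. Qed.

Lemma ReD (x y : C) : complex.Re (x + y) = complex.Re x + complex.Re y.
Proof. by case: x y => [a b] [c d]. Qed.
Lemma ReN (x : C) : complex.Re (- x) = - complex.Re x.
Proof. by case: x. Qed.
Lemma Re_conjc (x : C) : complex.Re (conjc x) = complex.Re x.
Proof. by case: x. Qed.

(** Polarization: the form at [x + y] and at [x + i y], for basis vectors [x] and [y], isolates each
    entry of [B]. *)
Lemma quad_form_eq0 d (B : 'M[C]_d) :
  (forall v : 'cV[C]_d, (v^H *m B *m v) 0 0 = 0) -> B = 0.
Proof.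
move=> B0; apply/matrixP => i j.
have q0 (v : 'cV[C]_d) : v^H *m B *m v = 0.
  by apply/matrixP => a b; rewrite (ord1 a) (ord1 b) B0 mxE.
pose x : 'cV[C]_d := delta_mx i 0; pose y : 'cV[C]_d := delta_mx j 0.
have h1 := q0 (x + y); have h2 := q0 (x + 'i%C *: y).
rewrite !(mx_adjD, mulmxDl, mulmxDr) !q0 add0r addr0 in h1.
rewrite !(mx_adjD, mx_adjZ, mulmxDl, mulmxDr) q0 in h2.
rewrite -!(scalemxAl, scalemxAr) q0 !scaler0 add0r addr0 in h2.
have h3 : x^H *m B *m y = 0.
  have e1 : y^H *m B *m x = - (x^H *m B *m y).
    by apply/eqP; rewrite -addr_eq0 h1.
  move: h2; rewrite e1 /= scalerN -scaleNr -scalerDl => /eqP.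
  rewrite scaler_eq0 => /orP[|/eqP//]; rewrite eq_complex /=.
  by move/andP => [_ /eqP] h; exfalso; move: h; lra.
by move/matrixP/(_ 0 0): h3; rewrite mx_adj_delta -rowE -colE !mxE => ->.
Qed.
End Adjoint.

(** * Spectral decompositions *)

Section Spectral.
Variable R : realType.
Local Notation C := R[i].

(** The order on complex numbers makes [0 <= z] include that [z] is real, so the quadratic form of
    [A^H - A] vanishes. *)
Lemma psd_adj d (A : 'M[C]_d) : is_psd A -> A^H = A.
Proof.
move=> Apsd; apply/eqP; rewrite -subr_eq0; apply/eqP/quad_form_eq0 => v.
have zE : (v^H *m A^H *m v) 0 0 = conjc ((v^H *m A *m v) 0 0).
  by rewrite -mx_adjE !mx_adjM mx_adjK mulmxA.
rewrite mulmxBr mulmxBl [LHS]mxE [X in _ + X]mxE zE.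
move: (Apsd v); case: (_ 0 0) => a b; rewrite lecE /= => /andP[/eqP -> _].
by apply/eqP; rewrite eq_complex /= !subrr !oppr0 !addr0 !eqxx.
Qed.

Lemma is_spectral_exists d (A : 'M[C]_d) : A^H = A ->
  exists Ul : 'M[C]_d * 'rV[R]_d, is_spectral A Ul.1 Ul.2.
Proof.
move=> AH.
have Aherm : A \is hermsymmx.
  by apply/is_hermitianmxP; rewrite expr0 scale1r -[LHS]AH.
have /orthomx_spectralP AE := hermitian_normalmx Aherm.
have /mxOverP lreal := hermitian_spectral_diag_real Aherm.
have PH : (spectralmx A)^H = invmx (spectralmx A).
  by rewrite (invmx_unitary (spectral_unitarymx A)).
(* The spectral theorem is supplied as [A = P^-1 D P] with [P] unitary, so the matrix of
   eigenvectors is the adjoint of [P]. *)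
exists ((spectralmx A)^H, map_mx (@complex.Re R) (spectral_diag A)); split => /=.
  by rewrite /is_unitary mx_adjK PH mulVmx // spectral_unit.
rewrite mx_adjK PH [LHS]AE; congr (_ *m diag_mx _ *m _).
by apply/matrixP => i j; rewrite !mxE /embC RRe_real.
Qed.

Lemma spec_pairP d (A : 'M[C]_d) : A^H = A ->
  is_spectral A (spec_pair A).1 (spec_pair A).2.
Proof. by move=> /is_spectral_exists; apply: epsilon_spec. Qed.

Lemma unitary_adjl d (U : 'M[C]_d) : is_unitary U -> U^H *m U = 1%:M.
Proof. by move/mulmx1C. Qed.

Lemma is_spectral_conj d (A U : 'M[C]_d) l : is_spectral A U l ->
  U^H *m A *m U = diag_mx (map_mx (@embC R) l).
Proof.
move=> [/unitary_adjl UU ->].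
by rewrite !mulmxA UU mul1mx -mulmxA UU mulmx1.
Qed.

Lemma mxtrace_mul_conj_diag d (B U : 'M[C]_d) (D : 'rV[C]_d) :
  \tr (B *m (U *m diag_mx D *m U^H)) = \sum_j (U^H *m B *m U) j j * D 0 j.
Proof.
rewrite !mulmxA mxtrace_mulC !mulmxA mul_mx_diag.
by apply: eq_bigr => j _; rewrite mxE.
Qed.

Lemma quad_form_diag d (l : 'rV[R]_d) (v : 'cV[C]_d) :
  (v^H *m diag_mx (map_mx (@embC R) l) *m v) 0 0 =
  embC (\sum_i l 0 i * sqmod (v i 0)).
Proof.
rewrite mxE /embC rmorph_sum; apply: eq_bigr => j _.
rewrite mul_mx_diag mxE mx_adjE mxE mulrAC rmorphM /= mulrC; congr (_ * _).
by rewrite mulrC mul_conjc.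
Qed.

Lemma is_spectral_quad_form d (A U : 'M[C]_d) l (v : 'cV[C]_d) :
  is_spectral A U l ->
  (v^H *m A *m v) 0 0 = embC (\sum_i l 0 i * sqmod ((U^H *m v) i 0)).
Proof.
by move=> [_ ->]; rewrite -quad_form_diag mx_adjM mx_adjK !mulmxA.
Qed.

Lemma psd_eigenvalue_ge0 d (A U : 'M[C]_d) l i :
  is_psd A -> is_spectral A U l -> 0 <= l 0 i.
Proof.
move=> /(_ (U *m delta_mx i 0)) + As.
rewrite mx_adjM !mulmxA -(mulmxA _ U^H) -(mulmxA _ _ U) (is_spectral_conj As).
rewrite quad_form_diag lecR (bigD1 i) //= big1 ?addr0 => [|j ji].
  by rewrite mxE !eqxx /sqmod /= expr1n expr0n addr0 mulr1.
by rewrite mxE (negbTE ji) /sqmod /= expr0n addr0 mulr0.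
Qed.

(** In an eigenbasis the form is a sum of nonnegative terms [l_i |v_i|^2]; each one vanishes, hence
    so does each [l_i v_i]. *)
Lemma psd_quad_form_eq0 d (A : 'M[C]_d) (v : 'cV[C]_d) :
  is_psd A -> (v^H *m A *m v) 0 0 = 0 -> A *m v = 0.
Proof.
move=> Apsd; have As := spec_pairP (psd_adj Apsd).
set U := (spec_pair A).1 in As; set l := (spec_pair A).2 in As.
rewrite (is_spectral_quad_form _ As) => /complexI /eqP.
rewrite psumr_eq0 => [/allP l0|i _]; last first.
  by rewrite mulr_ge0 ?sqmod_ge0 // (psd_eigenvalue_ge0 _ Apsd As).
have [_ ->] := As; rewrite -!mulmxA; apply/eqP.
suff -> : diag_mx (map_mx (@embC R) l) *m (U^H *m v) = 0 by rewrite mulmx0.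
apply/matrixP => i j; rewrite (ord1 j) mul_diag_mx [LHS]mxE [X in X * _]mxE [RHS]mxE.
have /(_ (mem_index_enum _)) := l0 i; rewrite /= mulf_eq0 => /orP[/eqP->|/eqP/sqmod_eq0->].
  by rewrite mul0r.
by rewrite mulr0.
Qed.

Lemma is_psdD d (A B : 'M[C]_d) : is_psd A -> is_psd B -> is_psd (A + B).
Proof.
by move=> Ap Bp v; rewrite mulmxDr mulmxDl mxE addr_ge0.
Qed.

Lemma is_psdZ d (t : R) (A : 'M[C]_d) : 0 <= t -> is_psd A -> is_psd (embC t *: A).
Proof.
by move=> t0 Ap v; rewrite -scalemxAr -scalemxAl mxE mulr_ge0 // ler0c.
Qed.

(** With its column counterpart: the squared moduli of a unitary matrix form a doubly stochastic
    matrix, so the overlaps of two eigenbases act as probability weights. *)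
Lemma sum_sqmod_row d (V : 'M[C]_d) i : is_unitary V -> \sum_j sqmod (V i j) = 1.
Proof.
move=> /matrixP/(_ i i); rewrite !mxE eqxx => VV; apply: complexI.
rewrite -[RHS]VV rmorph_sum; apply: eq_bigr => j _.
by rewrite mx_adjE mul_conjc.
Qed.

Lemma sum_sqmod_col d (V : 'M[C]_d) j : is_unitary V -> \sum_i sqmod (V i j) = 1.
Proof.
move=> /unitary_adjl/matrixP/(_ j j); rewrite !mxE eqxx => VV; apply: complexI.
rewrite -[RHS]VV rmorph_sum; apply: eq_bigr => i _.
by rewrite mx_adjE mulrC mul_conjc.
Qed.

Lemma is_spectral_conj_diag d (A U W : 'M[C]_d) l j : is_spectral A U l ->
  (W^H *m A *m W) j j = embC (\sum_i sqmod ((U^H *m W) i j) * l 0 i).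
Proof.
move=> As.
pose e : 'cV[C]_d := delta_mx j 0.
have -> : (W^H *m A *m W) j j = ((W *m e)^H *m A *m (W *m e)) 0 0.
  by rewrite mx_adjM mx_adj_delta !mulmxA -rowE -!row_mul -colE [RHS]mxE [RHS]mxE.
rewrite (is_spectral_quad_form _ As); congr embC; apply: eq_bigr => i _.
by rewrite mulmxA -colE [col _ _ _ _]mxE mulrC.
Qed.

(** The diagonal of [rho] in the eigenbasis of [sigma] is the overlap average of [p], and the term
    in [ln (p 0 i)] is spread over [j] because the overlaps sum to 1. The decompositions are those
    chosen by [spec_pair], from which [mxlog] is computed. *)
Lemma rel_ent_qE d (rho sigma U W : 'M[C]_d) p q :
  rho^H = rho -> sigma^H = sigma ->
  U = (spec_pair rho).1 -> p = (spec_pair rho).2 ->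
  W = (spec_pair sigma).1 -> q = (spec_pair sigma).2 ->
  rel_ent_q rho sigma =
  \sum_i \sum_j sqmod ((U^H *m W) i j) * p 0 i * (ln (p 0 i) - ln (q 0 j)).
Proof.
move=> /spec_pairP + /spec_pairP + -> -> -> ->.
set P := spec_pair rho; set Q := spec_pair sigma => rs ss.
rewrite /rel_ent_q mulmxBr raddfB /= ReD ReN /mxlog /mxfun -/P -/Q.
rewrite !mxtrace_mul_conj_diag (is_spectral_conj rs) !Re_sum.
under [X in _ - X]eq_bigr => j _.
  rewrite (is_spectral_conj_diag _ _ rs) mxE Re_mulr_embC Re_embC mulr_suml. over.
under [RHS]eq_bigr => i _ do (under eq_bigr => j _ do rewrite mulrBr; rewrite big_split /= sumrN).
rewrite big_split /= sumrN; congr (_ - _); last by rewrite exchange_big.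
apply: eq_bigr => i _; rewrite -!mulr_suml sum_sqmod_row ?mul1r.
  by rewrite !mxE eqxx mulr1n Re_mulr_embC.
have [/unitary_adjl U1 _] := rs; have [W1 _] := ss.
by rewrite /is_unitary mx_adjM mx_adjK !mulmxA -(mulmxA _ Q.1) W1 mulmx1.
Qed.
End Spectral.

(** * The adjoint of a channel *)

Section Monotone.
Variable R : realType.
Local Notation C := R[i].

(** Riesz representation for the trace pairing; the entry [Y i j] is the value of [L] at the matrix
    unit [delta_mx j i]. It provides the adjoint of a channel. *)
Lemma linear_fun_is_mxtrace a (L : 'M[C]_a -> C) :
  (forall (c : C) X Y, L (c *: X + Y) = c * L X + L Y) ->
  exists Y : 'M[C]_a, forall Z, \tr (Y *m Z) = L Z.
Proof.
move=> Ll; have L0 : L 0 = 0.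
  by have := Ll (-1) 0 0; rewrite scaler0 addr0 mulN1r addNr.
have Ls (I : Type) (r : seq I) (F : I -> C) (G : I -> 'M[C]_a) :
    L (\sum_(i <- r) F i *: G i) = \sum_(i <- r) F i * L (G i).
  by elim: r => [|i r IH]; rewrite ?big_nil // !big_cons Ll IH.
have LD X Y : L (X + Y) = L X + L Y by rewrite -[X]scale1r Ll mul1r scale1r.
exists (\matrix_(i, j) L (delta_mx j i)) => Z.
rewrite [in RHS](matrix_sum_delta Z) (big_morph L LD L0).
transitivity (\sum_i \sum_k L (delta_mx k i) * Z k i).
  by apply: eq_bigr => i _; rewrite mxE; apply: eq_bigr => k _; rewrite mxE.
rewrite exchange_big /=; apply: eq_bigr => k _; rewrite Ls.
by apply: eq_bigr => i _; rewrite mulrC.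
Qed.

(** Allows a trace inequality to be obtained by summing vector inequalities over the standard
    basis. *)
Lemma mxtrace_sum_quad_form a b (A D : 'M[C]_(a, b)) (B : 'M[C]_a) :
  \tr (A^H *m B *m D) =
  \sum_c ((A *m delta_mx c (0 : 'I_1))^H *m B *m (D *m delta_mx c (0 : 'I_1))) 0 0.
Proof.
apply: eq_bigr => c _.
by rewrite mx_adjM mx_adj_delta !mulmxA -rowE -!row_mul -colE [RHS]mxE [RHS]mxE.
Qed.

(* The last clause is the positivity of the image under [id_2 (x) M] of the positive
   block matrix [[sigma, sigma Y], [Y^H sigma, Y^H sigma Y]]. *)
Definition adj_pos (a b : nat) (M : 'M[C]_a -> 'M[C]_b) : Prop :=
  [/\ is_linear_map M, trace_preserving M,
    forall Z, (M Z)^H = M Z^H &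
    forall sigma Y (u v : 'cV[C]_b), is_psd sigma ->
      0 <= (u^H *m M sigma *m u) 0 0 + (u^H *m M (sigma *m Y) *m v) 0 0
         + (v^H *m M (Y^H *m sigma) *m u) 0 0
         + (v^H *m M (Y^H *m sigma *m Y) *m v) 0 0].

Section Channel.
Variables (a b : nat) (M : 'M[C]_a -> 'M[C]_b).
Hypothesis Mpos : adj_pos M.

Lemma channel_psd sigma : is_psd sigma -> is_psd (M sigma).
Proof.
case: Mpos => _ _ _ M4 sp u; have := M4 sigma 0 u 0 sp.
rewrite mx_adj0 !(mul0mx, mulmx0).
by rewrite [X in _ + X]mxE [X in _ + X + _]mxE [X in _ + X + _ + _]mxE !addr0.
Qed.

(* Kadison-Schwarz for the adjoint of M, which maps X to Y. *)
Lemma schwarz_right (X : 'M[C]_b) (Y sigma : 'M[C]_a) :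
  (forall Z, \tr (Y *m Z) = \tr (X *m M Z)) -> is_psd sigma ->
  complex.Re (\tr (sigma *m (Y *m Y^H))) <= complex.Re (\tr (M sigma *m (X *m X^H))).
Proof.
case: Mpos => Ml Mt Mh M4 YX sp.
have M4s := M4 sigma Y _ _ sp.
pose e c : 'cV[C]_b := delta_mx c 0.
(* The positivity clause is taken at [u = X e_c] and [v = - e_c] and summed over [c]. With
   [T = tr (sigma Y Y^H)], the last three terms become [- conj T], [- T] and, by trace preservation,
   [T]. *)
have : 0 <= \sum_c (((X *m e c)^H *m M sigma *m (X *m e c)) 0 0 +
    ((X *m e c)^H *m M (sigma *m Y) *m ((- 1%:M) *m e c)) 0 0 +
    (((- 1%:M) *m e c)^H *m M (Y^H *m sigma) *m (X *m e c)) 0 0 +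
    (((- 1%:M) *m e c)^H *m M (Y^H *m sigma *m Y) *m ((- 1%:M) *m e c)) 0 0).
  by apply: sumr_ge0 => c _.
rewrite !big_split /= -!mxtrace_sum_quad_form.
have N1 : (- 1%:M : 'M[C]_b)^H = - 1%:M.
  by rewrite -scaleN1r mx_adjZ mx_adj1 rmorphN rmorph1.
rewrite !N1 !(mulNmx, mulmxN) opprK !mul1mx !mulmx1 !raddfN /=.
have e3 : \tr (M (Y^H *m sigma) *m X) = \tr (sigma *m (Y *m Y^H)).
  by rewrite mxtrace_mulC -YX mulmxA mxtrace_mulC.
have sH := psd_adj sp.
have e2 : \tr (X^H *m M (sigma *m Y)) = conjc (\tr (sigma *m (Y *m Y^H))).
  by rewrite -e3 -mxtrace_adj mx_adjM Mh mx_adjM mx_adjK sH.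
have e4 : \tr (M (Y^H *m sigma *m Y)) = \tr (sigma *m (Y *m Y^H)).
  by rewrite Mt -mulmxA mxtrace_mulC mulmxA.
have e1 : \tr (X^H *m M sigma *m X) = \tr (M sigma *m (X *m X^H)).
  by rewrite -mulmxA mxtrace_mulC mulmxA.
rewrite e1 e2 e3 e4 lecE /= !(ReD, ReN) Re_conjc => /andP[_]; lra.
Qed.

(** As [M] commutes with [^H], the adjoint channel also sends [X^H] to [Y^H], and [schwarz_right]
    applies to this pair. *)
Lemma schwarz_left (X : 'M[C]_b) (Y rho : 'M[C]_a) :
  (forall Z, \tr (Y *m Z) = \tr (X *m M Z)) -> is_psd rho ->
  complex.Re (\tr (rho *m (Y^H *m Y))) <= complex.Re (\tr (M rho *m (X^H *m X))).
Proof.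
case: Mpos => Ml Mt Mh M4 YX rp.
have := @schwarz_right X^H Y^H rho; rewrite !mx_adjK; apply => // Z.
rewrite mxtrace_mulC -[Z]mx_adjK -mx_adjM mxtrace_adj YX -mxtrace_adj mx_adjM.
by rewrite -Mh mx_adjK mxtrace_mulC mx_adjK.
Qed.

Lemma adjoint_exists (X : 'M[C]_b) :
  exists Y, forall Z, \tr (Y *m Z) = \tr (X *m M Z).
Proof.
case: Mpos => Ml _ _ _; apply: linear_fun_is_mxtrace => c Z Z'.
by rewrite Ml mulmxDr raddfD /= -scalemxAr linearZ.
Qed.

(** Pull [v v^H] back to [Y]. If [M sigma] kills [v], Kadison-Schwarz gives [tr (sigma Y Y^H) <= 0],
    hence [sigma Y = 0], then [rho Y = 0] by support inclusion, and the form of [M rho] at [v] is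
    [tr (Y rho) = 0]. *)
Lemma channel_supp_incl (rho sigma : 'M[C]_a) :
  is_psd rho -> is_psd sigma -> supp_incl_q rho sigma ->
  supp_incl_q (M rho) (M sigma).
Proof.
move=> rp sp rs v Mv0; apply: (psd_quad_form_eq0 (channel_psd rp)).
have [Y YX] := adjoint_exists (v *m v^H).
have := schwarz_right YX sp; rewrite mulmxA -(mulmxA v) !mulmxA Mv0 !mul0mx mxtrace0 /=.
have YsE : \tr (sigma *m Y *m Y^H) = \tr (Y^H *m sigma *m Y).
  by rewrite mxtrace_mulC mulmxA.
rewrite YsE.
have Ys0 c : 0 <= ((Y *m delta_mx c (0 : 'I_1))^H *m sigma *m (Y *m delta_mx c (0 : 'I_1))) 0 0.
  exact: sp.
rewrite mxtrace_sum_quad_form Re_sum => sle0.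
have rY : rho *m Y = 0.
  apply/matrixP => i c; rewrite mxE [RHS]mxE.
  have /rs : sigma *m (Y *m delta_mx c (0 : 'I_1)) = 0.
    apply: (psd_quad_form_eq0 sp); apply/eqP; rewrite eq_complex /=; apply/andP; split; last first.
      by have := Ys0 c; rewrite lecE => /andP[].
    have F0 k : 0 <= complex.Re
        (((Y *m delta_mx k (0 : 'I_1))^H *m sigma *m (Y *m delta_mx k (0 : 'I_1))) 0 0).
      by have := Ys0 k; rewrite lecE => /andP[].
    move: sle0; rewrite (bigD1 c) //= => sle0; apply/eqP/le_anti; rewrite F0 andbT.
    by apply: le_trans sle0; rewrite lerDl; apply: sumr_ge0.
  by rewrite mulmxA -colE => /matrixP/(_ i 0); rewrite !mxE.
have := YX rho; rewrite mxtrace_mulC rY mxtrace0 -mulmxA mxtrace_mulC => /esym.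
by rewrite trace_mx11.
Qed.
End Channel.
End Monotone.

(** * Variational formula *)

Section Variational.
Variable R : realType.
Local Notation C := R[i].

(** Complete the square: with [c = q + s p], the difference of the two sides times [c] is
    [|c z - p conj v|^2]. The case [p = 0] is separate because [c] may then vanish. *)
Lemma sqmod_quadratic_le (z v : C) (p q s : R) : 0 <= p -> 0 <= q -> 0 < s ->
  2 * (complex.Re (z * v) * p) - q * sqmod z - s * (p * sqmod z)
  <= sqmod v * p * (p / (q + s * p)).
Proof.
move=> p0 q0 s0; have [->|pN0] := eqVneq p 0.
  rewrite !(mulr0, mul0r, subr0, addr0, sub0r) oppr_le0.
  by rewrite mulr_ge0 // sqmod_ge0.
have c0 : 0 < q + s * p by rewrite ltr_wpDl // mulr_gt0 // lt0r pN0.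
set c := q + s * p in c0 *.
have -> : sqmod v * p * (p / c) = sqmod v * p ^+ 2 / c by rewrite expr2 !mulrA.
rewrite ler_pdivlMr //.
case: z v => [z1 z2] [v1 v2]; rewrite /sqmod /=.
have h1 := sqr_ge0 (c * z1 - p * v1); have h2 := sqr_ge0 (c * z2 + p * v2).
rewrite -subr_ge0; move: (addr_ge0 h1 h2); congr (0 <= _).
rewrite /c; ring.
Qed.

(** For [p != 0] the chosen [z] is the zero of the completed square; for [p = 0] both sides are
    0. *)
Lemma sqmod_quadratic_attained (v : C) (p q s : R) : 0 <= p -> 0 <= q -> 0 < s ->
  let z := embC (p / (q + s * p)) * conjc v in
  2 * (complex.Re (z * v) * p) - q * sqmod z - s * (p * sqmod z)
  = sqmod v * p * (p / (q + s * p)).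
Proof.
move=> p0 q0 s0 z; have [pE0|pN0] := eqVneq p 0.
  have -> : z = 0 by rewrite /z pE0 mul0r /embC rmorph0 mul0r.
  by rewrite pE0 mul0r /sqmod /=; ring.
have c0 : q + s * p != 0 by rewrite gt_eqF // ltr_wpDl // mulr_gt0 // lt0r pN0.
rewrite {}/z; case: v => [v1 v2]; rewrite /sqmod /=; field.
exact: c0.
Qed.

Section States.
Variables (d : nat) (rho sigma U W : 'M[C]_d) (p q : 'rV[R]_d).
Hypotheses (rs : is_spectral rho U p) (ss : is_spectral sigma W q).
Local Notation V := (U^H *m W).

(* Z is Y written in the eigenbases; the form decouples over its entries. *)
Lemma var_form (Y : 'M[C]_d) (s : R) :
  let Z := W^H *m Y *m U in
  2 * complex.Re (\tr (Y *m rho)) - complex.Re (\tr (sigma *m (Y *m Y^H)))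
    - s * complex.Re (\tr (rho *m (Y^H *m Y)))
  = \sum_i \sum_j (2 * (complex.Re (Z j i * V i j) * p 0 i)
      - q 0 j * sqmod (Z j i) - s * (p 0 i * sqmod (Z j i))).
Proof.
move=> Z; have [Uu rE] := rs; have [Wu sE] := ss.
have UU := unitary_adjl Uu; have WW := unitary_adjl Wu.
have e1 : complex.Re (\tr (Y *m rho)) = \sum_i \sum_j complex.Re (Z j i * V i j) * p 0 i.
  rewrite rE mxtrace_mul_conj_diag Re_sum; apply: eq_bigr => i _.
  rewrite [X in _ * X]mxE Re_mulr_embC -mulr_suml -Re_sum; congr (complex.Re _ * _).
  have -> : U^H *m Y *m U = V *m Z.
    by rewrite /Z !mulmxA -(mulmxA _ W) Wu mulmx1.
  by rewrite [LHS]mxE; apply: eq_bigr => j _; rewrite mulrC.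
have e2 : complex.Re (\tr (sigma *m (Y *m Y^H))) = \sum_i \sum_j q 0 j * sqmod (Z j i).
  rewrite mxtrace_mulC sE mxtrace_mul_conj_diag Re_sum exchange_big; apply: eq_bigr => j _ /=.
  rewrite [X in _ * X]mxE Re_mulr_embC mulrC -mulr_sumr; congr (_ * _).
  have -> : W^H *m (Y *m Y^H) *m W = Z *m Z^H.
    by rewrite /Z !mx_adjM mx_adjK !mulmxA -(mulmxA _ U) Uu mulmx1.
  rewrite mxE Re_sum; apply: eq_bigr => i _.
  by rewrite mx_adjE mul_conjc.
have e3 : complex.Re (\tr (rho *m (Y^H *m Y))) = \sum_i \sum_j p 0 i * sqmod (Z j i).
  rewrite mxtrace_mulC rE mxtrace_mul_conj_diag Re_sum; apply: eq_bigr => i _ /=.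
  rewrite [X in _ * X]mxE Re_mulr_embC mulrC -mulr_sumr; congr (_ * _).
  have -> : U^H *m (Y^H *m Y) *m U = Z^H *m Z.
    by rewrite /Z !mx_adjM mx_adjK !mulmxA -(mulmxA _ W) Wu mulmx1.
  rewrite mxE Re_sum; apply: eq_bigr => j _.
  by rewrite mx_adjE mulrC mul_conjc.
rewrite e1 e2 e3 !mulr_sumr -!sumrB; apply: eq_bigr => i _.
by rewrite !mulr_sumr -!sumrB.
Qed.

Hypotheses (p0 : forall i, 0 <= p 0 i) (q0 : forall j, 0 <= q 0 j).

(** Together with [var_form_attained], this is the description of F'(s) as a maximum over [Y]; both
    follow entry by entry from the scalar case. *)
Lemma var_form_le (Y : 'M[C]_d) (s : R) : 0 < s ->
  2 * complex.Re (\tr (Y *m rho)) - complex.Re (\tr (sigma *m (Y *m Y^H)))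
    - s * complex.Re (\tr (rho *m (Y^H *m Y)))
  <= \sum_i \sum_j sqmod (V i j) * p 0 i * (p 0 i / (q 0 j + s * p 0 i)).
Proof.
move=> s0; rewrite var_form; apply: ler_sum => i _; apply: ler_sum => j _.
exact: sqmod_quadratic_le.
Qed.

Lemma var_form_attained (s : R) : 0 < s -> exists Y : 'M[C]_d,
  2 * complex.Re (\tr (Y *m rho)) - complex.Re (\tr (sigma *m (Y *m Y^H)))
    - s * complex.Re (\tr (rho *m (Y^H *m Y)))
  = \sum_i \sum_j sqmod (V i j) * p 0 i * (p 0 i / (q 0 j + s * p 0 i)).
Proof.
move=> s0.
pose Z : 'M[C]_d := \matrix_(j, i) (embC (p 0 i / (q 0 j + s * p 0 i)) * conjc (V i j)).
exists (W *m Z *m U^H); rewrite var_form.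
have [Uu _] := rs; have [Wu _] := ss.
have -> : W^H *m (W *m Z *m U^H) *m U = Z.
  rewrite !mulmxA (unitary_adjl Wu) mul1mx -mulmxA (unitary_adjl Uu).
  exact: mulmx1.
apply: eq_bigr => i _; apply: eq_bigr => j _.
rewrite [Z j i]mxE; exact: sqmod_quadratic_attained.
Qed.
End States.

Lemma overlap_unitary d (U W : 'M[C]_d) :
  is_unitary U -> is_unitary W -> is_unitary (U^H *m W).
Proof.
move=> Uu Wu; rewrite /is_unitary mx_adjM mx_adjK !mulmxA -(mulmxA _ W) Wu mulmx1.
exact: unitary_adjl.
Qed.

(** If [q_j = 0], the j-th eigenvector of [sigma] lies in the kernel of [sigma], hence in that of
    [rho]. Its i-th coordinate in the eigenbasis of [rho] then gives [p_i V_ij = 0], against the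
    nonzero weight. *)
Lemma pos_supp_overlap d (rho sigma U W : 'M[C]_d) (p q : 'rV[R]_d) :
  is_psd rho -> is_psd sigma -> supp_incl_q rho sigma ->
  is_spectral rho U p -> is_spectral sigma W q ->
  pos_supp (fun k : 'I_d * 'I_d => sqmod ((U^H *m W) k.1 k.2) * p 0 k.1)
    (fun k => p 0 k.1) (fun k => q 0 k.2).
Proof.
move=> rp sp rsupp rs ss -[i j] /=.
have p0 := psd_eigenvalue_ge0 i rp rs; have q0 := psd_eigenvalue_ge0 j sp ss.
split=> [|wN0]; first by rewrite mulr_ge0 // sqmod_ge0.
move: wN0; rewrite mulf_eq0 negb_or => /andP[VN0 pN0].
split; rewrite lt0r ?pN0 // q0 andbT; apply/eqP => qj0.
have [Uu rE] := rs; have [Wu sE] := ss.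
have /rsupp : sigma *m (W *m delta_mx j (0 : 'I_1)) = 0.
  rewrite sE -!mulmxA (mulmxA W^H) (unitary_adjl Wu) mul1mx.
  rewrite (_ : diag_mx _ *m _ = 0) ?mulmx0 //.
  apply/matrixP => k l; rewrite mul_diag_mx !mxE; have [->|] := eqVneq k j.
    by rewrite qj0 /embC rmorph0 mul0r.
  by rewrite mulr0.
move=> /(congr1 (mulmx U^H)); rewrite mulmx0 rE !mulmxA (unitary_adjl Uu) mul1mx.
rewrite -!mulmxA (mulmxA U^H) -colE mul_diag_mx => /matrixP/(_ i 0).
rewrite [LHS]mxE [X in X * _]mxE [RHS]mxE => /eqP; rewrite mulf_eq0.
move=> /orP[/eqP/complexI/eqP|/eqP]; first by rewrite (negbTE pN0).
by rewrite mxE => V0; move: VN0; rewrite V0 /sqmod /= expr0n addr0 eqxx.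
Qed.
End Variational.

(** * Data processing *)

Section DataProcessing.
Variable R : realType.
Local Notation C := R[i].

Lemma density_sum_eigenvalues d (rho U : 'M[C]_d) (p : 'rV[R]_d) :
  is_density rho -> is_spectral rho U p -> \sum_i p 0 i = 1.
Proof.
move=> [_ tr1] [Uu rE]; apply: complexI; rewrite -[RHS]tr1 -[rho]mul1mx rE.
rewrite mxtrace_mul_conj_diag mulmx1 (unitary_adjl Uu) rmorph_sum.
by apply: eq_bigr => i _; rewrite !mxE eqxx mul1r.
Qed.

Lemma sum_overlap d (rho U W : 'M[C]_d) (p : 'rV[R]_d) :
  is_density rho -> is_spectral rho U p -> is_unitary W ->
  \sum_(k : 'I_d * 'I_d) sqmod ((U^H *m W) k.1 k.2) * p 0 k.1 = 1.
Proof.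
move=> rd rs Wu; have [Uu _] := rs.
rewrite -(density_sum_eigenvalues rd rs).
rewrite -(pair_bigA _ (fun i j => sqmod ((U^H *m W) i j) * p 0 i)) /=.
apply: eq_bigr => i _; rewrite -mulr_suml sum_sqmod_row ?mul1r //.
exact: overlap_unitary.
Qed.

(** Klein's inequality: [sub_le_mul_ln] is applied to each pair of eigenvalues, and the lower bounds
    add up to 0 because the overlaps are doubly stochastic. *)
Lemma rel_ent_q_ge0 d (rho sigma : 'M[C]_d) :
  is_density rho -> is_density sigma -> supp_incl_q rho sigma ->
  0 <= rel_ent_q rho sigma.
Proof.
move=> rd sd rsupp; have [rp _] := rd; have [sp _] := sd.
have rs := spec_pairP (psd_adj rp); have ss := spec_pairP (psd_adj sp).
rewrite (rel_ent_qE (psd_adj rp) (psd_adj sp) erefl erefl erefl erefl).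
have wpq := pos_supp_overlap rp sp rsupp rs ss.
have Vu := overlap_unitary rs.1 ss.1.
move: (spec_pair rho) (spec_pair sigma) rs ss wpq Vu => [U p] [W q] /= rs ss wpq Vu.
have {1}<- : \sum_i \sum_j sqmod ((U^H *m W) i j) * (p 0 i - q 0 j) = 0.
  under eq_bigr => i _ do (under eq_bigr => j _ do rewrite mulrBr;
    rewrite sumrB -mulr_suml (sum_sqmod_row _ Vu) mul1r).
  rewrite sumrB (density_sum_eigenvalues rd rs) exchange_big /=.
  under eq_bigr => j _ do rewrite -mulr_suml (sum_sqmod_col _ Vu) mul1r.
  by rewrite (density_sum_eigenvalues sd ss) subrr.
apply: ler_sum => i _; apply: ler_sum => j _.
have [w0 wN0] := wpq (i, j); rewrite /= in w0 wN0.
rewrite -mulrA; have [->|VN0] := eqVneq (sqmod ((U^H *m W) i j)) 0; first by rewrite !mul0r.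
rewrite ler_wpM2l ?sqmod_ge0 // sub_le_mul_ln //.
- exact: psd_eigenvalue_ge0 rp rs.
- exact: psd_eigenvalue_ge0 sp ss.
by move=> pN0; have [] := wN0 (mulf_neq0 VN0 pN0) => _; rewrite lt0r => /andP[].
Qed.

Lemma channel_density a b (M : 'M[C]_a -> 'M[C]_b) rho :
  adj_pos M -> is_density rho -> is_density (M rho).
Proof.
move=> Mp [rp r1]; split; first exact: (channel_psd Mp).
by have [_ -> _ _] := Mp.
Qed.

Lemma rel_ent_q_monotone a b (M : 'M[C]_a -> 'M[C]_b) rho sigma :
  adj_pos M -> is_density rho -> is_density sigma -> supp_incl_q rho sigma ->
  rel_ent_q (M rho) (M sigma) <= rel_ent_q rho sigma.
Proof.
move=> Mp rd sd rsupp; have [rp _] := rd; have [sp _] := sd.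
have rd' := channel_density Mp rd; have sd' := channel_density Mp sd.
have [rp' _] := rd'; have [sp' _] := sd'.
have rsupp' := channel_supp_incl Mp rp sp rsupp.
have rs := spec_pairP (psd_adj rp); have ss := spec_pairP (psd_adj sp).
have rs' := spec_pairP (psd_adj rp'); have ss' := spec_pairP (psd_adj sp').
rewrite (rel_ent_qE (psd_adj rp) (psd_adj sp) erefl erefl erefl erefl).
rewrite (rel_ent_qE (psd_adj rp') (psd_adj sp') erefl erefl erefl erefl).
rewrite !pair_bigA; apply: log_shift_compare.
- exact: pos_supp_overlap ss.
- exact: pos_supp_overlap ss'.
- exact: sum_overlap rd rs ss.1.
- exact: sum_overlap rd' rs' ss'.1.
move=> s s0.
have p0 i := psd_eigenvalue_ge0 i rp rs; have q0 i := psd_eigenvalue_ge0 i sp ss.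
have p0' i := psd_eigenvalue_ge0 i rp' rs'; have q0' i := psd_eigenvalue_ge0 i sp' ss'.
(* [X] is optimal for the output states. Its pull-back [Y] is merely a competitor for the input
   states: its linear term is the same, and its two quadratic terms are no larger by
   Kadison-Schwarz. *)
have [X XE] := var_form_attained rs' ss' p0' q0' s0.
have [Y YX] := adjoint_exists Mp X.
have := var_form_le rs ss p0 q0 Y s0; rewrite !pair_bigA => /(le_trans _); apply.
move: XE; rewrite !pair_bigA => <-; rewrite -YX.
have h1 := schwarz_right Mp YX sp.
have h2 : s * complex.Re (\tr (rho *m (Y^H *m Y))) <= s * complex.Re (\tr (M rho *m (X^H *m X))).
  by rewrite ler_wpM2l ?(ltW s0) // (schwarz_left Mp YX rp).
by move: h1 h2; lra.
Qed.

End DataProcessing.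

(** * Complete positivity *)

Section Blocks.
Variable R : realType.
Local Notation C := R[i].

Lemma sum_mxtens_index k a (F : 'I_(k * a) -> C) :
  \sum_r F r = \sum_i \sum_x F (mxtens_index (i, x)).
Proof.
rewrite pair_bigA (reindex (@mxtens_index k a)) /=; last first.
  exists (@mxtens_unindex k a) => r _; [exact: mxtens_indexK|exact: mxtens_unindexK].
by apply: eq_bigr => -[i x].
Qed.

Definition mx_block k a (P : 'M[C]_(k * a)) i j : 'M[C]_a :=
  \matrix_(x, y) P (mxtens_index (i, x)) (mxtens_index (j, y)).

Definition block_mx_of k a (B : 'I_k -> 'I_k -> 'M[C]_a) : 'M[C]_(k * a) :=
  \matrix_(r, s) B (mxtens_unindex r).1 (mxtens_unindex s).1
    (mxtens_unindex r).2 (mxtens_unindex s).2.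

Definition col_block k a (v : 'cV[C]_(k * a)) i : 'cV[C]_a :=
  \col_x v (mxtens_index (i, x)) 0.

Definition block_col_of k a (u : 'I_k -> 'cV[C]_a) : 'cV[C]_(k * a) :=
  \col_r u (mxtens_unindex r).1 (mxtens_unindex r).2 0.

Lemma mx_blockK k a (B : 'I_k -> 'I_k -> 'M[C]_a) i j :
  mx_block (block_mx_of B) i j = B i j.
Proof. by apply/matrixP => x y; rewrite !mxE !mxtens_indexK. Qed.

Lemma col_blockK k a (u : 'I_k -> 'cV[C]_a) i : col_block (block_col_of u) i = u i.
Proof. by apply/matrixP => x y; rewrite !mxE !mxtens_indexK (ord1 y). Qed.

Lemma mx_block_ampl k a b (M : 'M[C]_a -> 'M[C]_b) (P : 'M[C]_(k * a)) i j :
  mx_block (ampl M P) i j = M (mx_block P i j).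
Proof. by apply/matrixP => x y; rewrite !mxE !mxtens_indexK. Qed.

Lemma mx_block_adj k a (P : 'M[C]_(k * a)) i j :
  (mx_block P i j)^H = mx_block P^H j i.
Proof. by apply/matrixP => x y; rewrite !(mxE, mx_adjE). Qed.

Lemma quad_formE a (A : 'M[C]_a) (u v : 'cV[C]_a) :
  (u^H *m A *m v) 0 0 = \sum_x \sum_y conjc (u x 0) * A x y * v y 0.
Proof.
rewrite mxE exchange_big; apply: eq_bigr => y _.
by rewrite mxE mulr_suml; apply: eq_bigr => x _; rewrite mx_adjE.
Qed.

Lemma quad_form_blocks k a (P : 'M[C]_(k * a)) (v : 'cV[C]_(k * a)) :
  (v^H *m P *m v) 0 0 =
  \sum_i \sum_j ((col_block v i)^H *m mx_block P i j *m col_block v j) 0 0.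
Proof.
rewrite quad_formE sum_mxtens_index; apply: eq_bigr => i _.
under eq_bigr => x _ do rewrite sum_mxtens_index.
rewrite exchange_big; apply: eq_bigr => j _; rewrite quad_formE.
by apply: eq_bigr => x _; apply: eq_bigr => y _; rewrite !mxE.
Qed.

(** The block matrix is [K^H sigma K] for the block row [(1, Y)], so its form at [(v0, v1)] is the
    form of [sigma] at [v0 + Y v1]. *)
Lemma psd_block2 a (sigma Y : 'M[C]_a) (K := fun i : 'I_2 => if i == 0 then 1%:M else Y) :
  is_psd sigma -> is_psd (block_mx_of (fun i j => (K i)^H *m sigma *m K j)).
Proof.
move=> sp v; rewrite quad_form_blocks !big_ord_recl !big_ord0 !mx_blockK /K /=.
set v0 := col_block v _; set v1 := col_block v _.
have := sp (v0 + Y *m v1).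
rewrite mx_adjD mx_adjM !(mulmxDl, mulmxDr) mx_adj1 !mul1mx !mulmx1 !addr0 !mulmxA.
by rewrite addrACA !mxE !addrA.
Qed.

Lemma is_psd1 a : is_psd (1%:M : 'M[C]_a).
Proof.
move=> v; rewrite mulmx1 mxE; apply: sumr_ge0 => i _.
by rewrite mx_adjE mulrC mulcJ_ge0.
Qed.

Lemma cptp_adj_pos a b (M : 'M[C]_a -> 'M[C]_b) : cptp M -> adj_pos M.
Proof.
move=> [Ml Mt Mcp]; split => // [Z|sigma Y u v sp].
  (* The image of the positive block matrix [[[1, Z], [Z^H, Z^H Z]]] is positive, hence hermitian;
     comparing its off-diagonal blocks shows that [M] commutes with [^H]. *)
  have /psd_adj := Mcp _ _ (psd_block2 Z (@is_psd1 a)).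
  move=> /(congr1 (fun P => mx_block P (lift ord0 ord0) ord0)).
  rewrite -mx_block_adj !mx_block_ampl !mx_blockK /=.
  by rewrite mx_adj1 !mul1mx !mulmx1.
have := Mcp _ _ (psd_block2 Y sp) (block_col_of (fun i => if i == 0 then u else v)).
rewrite quad_form_blocks !big_ord_recl !big_ord0 !mx_block_ampl !mx_blockK !col_blockK /=.
by rewrite mx_adj1 !mul1mx !mulmx1 !addr0 !addrA.
Qed.

Lemma cptp_comp a b c (M : 'M[C]_a -> 'M[C]_b) (N : 'M[C]_b -> 'M[C]_c) :
  cptp M -> cptp N -> cptp (fun X => N (M X)).
Proof.
move=> [Ml Mt Mc] [Nl Nt Nc]; split=> [x X Y|X|k P Pp]; first by rewrite Ml Nl.
  by rewrite Nt Mt.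
rewrite (_ : ampl _ P = ampl N (ampl M P)); first exact/Nc/Mc.
apply/matrixP => r s; rewrite !mxE; congr (N _ _ _).
by apply/matrixP => x y; rewrite !mxE !mxtens_indexK.
Qed.

(** Moving each Kraus operator onto the vector turns the form of [ampl M P] at [v] into a sum over
    [l] of forms of [P], at the vectors with blocks [(L l)^H v_i]. *)
Lemma kraus_completely_positive a b (I : finType) (L : I -> 'M[C]_(b, a))
  (M : 'M[C]_a -> 'M[C]_b) :
  (forall X, M X = \sum_l L l *m X *m (L l)^H) -> completely_positive M.
Proof.
move=> ME k P Pp v; rewrite quad_form_blocks.
have -> : \sum_i \sum_j ((col_block v i)^H *m mx_block (ampl M P) i j *m col_block v j) 0 0
  = \sum_l ((block_col_of (fun i => (L l)^H *m col_block v i))^H *m P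
      *m block_col_of (fun i => (L l)^H *m col_block v i)) 0 0.
  under [RHS]eq_bigr => l _ do rewrite quad_form_blocks.
  rewrite [RHS]exchange_big; apply: eq_bigr => i _.
  rewrite [RHS]exchange_big; apply: eq_bigr => j _.
  rewrite mx_block_ampl ME mulmx_sumr mulmx_suml summxE; apply: eq_bigr => l _.
  by rewrite !col_blockK mx_adjM mx_adjK !mulmxA.
by apply: sumr_ge0 => l _.
Qed.

Lemma compl_channel_cptp a b e (V : 'M[C]_(b * e, a)) :
  is_isometry V -> cptp (compl_channel V).
Proof.
move=> Viso; split.
- move=> c X Y; rewrite /compl_channel mulmxDr mulmxDl -scalemxAr -scalemxAl.
  apply/matrixP => i j; rewrite !mxE mulr_sumr -big_split.
  by apply: eq_bigr => k _; rewrite !mxE.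
- move=> X; rewrite -[X in RHS]mulmx1 -Viso mulmxA mxtrace_mulC mulmxA.
  rewrite [RHS]sum_mxtens_index exchange_big; apply: eq_bigr => i _.
  by rewrite mxE.
(* The Kraus operators are the slices [(<k| (x) 1) V], with [k] running over the basis of the
   traced-out output space. *)
apply: (@kraus_completely_positive a e 'I_b
  (fun k => \matrix_(i, x) V (mxtens_index (k, i)) x)) => X.
apply/matrixP => i j; rewrite mxE summxE; apply: eq_bigr => k _.
rewrite !mxE; apply: eq_bigr => y _; rewrite !mxE; congr (_ * _).
by apply: eq_bigr => x _; rewrite !mxE.
Qed.
End Blocks.

(** * Contraction coefficients *)

Section Ratios.
Variable R : realType.
Local Notation C := R[i].

(** Containment in [[0, 1]] makes [sup S] a genuine supremum. If [D = 0], the bounds force [D' = 0]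
    and no ratio is involved. *)
Lemma le_sup_ratio (S : set R) (D D' : R) : (forall r, S r -> 0 <= r <= 1) ->
  0 <= D' <= D -> (D != 0 -> S (D' / D)) -> D' <= sup S * D.
Proof.
move=> S01 /andP[D'0 D'D] SD; have [D0|DN0] := eqVneq D 0.
  by rewrite D0 mulr0 -D0.
have {}DN0 : 0 < D by rewrite lt0r (le_trans D'0 D'D) DN0.
rewrite -ler_pdivrMr //; apply: ub_le_sup; last exact/SD/lt0r_neq0.
by exists 1 => r /S01 /andP[].
Qed.

Lemma inf_ratio_le (S : set R) (D D' : R) : (forall r, S r -> 0 <= r <= 1) ->
  0 <= D' <= D -> (D != 0 -> S (D' / D)) -> inf S * D <= D'.
Proof.
move=> S01 /andP[D'0 D'D] SD; have [D0|DN0] := eqVneq D 0.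
  by rewrite D0 mulr0.
have {}DN0 : 0 < D by rewrite lt0r (le_trans D'0 D'D) DN0.
rewrite -ler_pdivlMr //; apply: ge_inf; last exact/SD/lt0r_neq0.
by exists 0 => r /S01 /andP[].
Qed.

(** For [D = 0] the quotient is 0 by convention, which avoids proving that a relative entropy
    vanishes only on equal states. *)
Lemma ratio_01 (D D' : R) : 0 <= D' <= D -> 0 <= D' / D <= 1.
Proof.
move=> /andP[D'0 D'D]; rewrite divr_ge0 ?(le_trans D'0) //=.
have [->|DN0] := eqVneq D 0; first by rewrite invr0 mulr0.
by rewrite ler_pdivrMr ?mul1r // lt0r (le_trans D'0 D'D) DN0.
Qed.

(** * Coefficients of quantum channels *)

Section Quantum.
Variables (a b : nat) (M : 'M[C]_a -> 'M[C]_b).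
Hypothesis Mcptp : cptp M.

Lemma rel_ent_q_bounds rho sigma : is_density rho -> is_density sigma ->
  supp_incl_q rho sigma ->
  0 <= rel_ent_q (M rho) (M sigma) <= rel_ent_q rho sigma.
Proof.
move=> rd sd rs; have Mp := cptp_adj_pos Mcptp; rewrite rel_ent_q_monotone // andbT.
apply: rel_ent_q_ge0; [exact: channel_density..|].
by apply: channel_supp_incl => //; [case: rd|case: sd].
Qed.

Lemma ratio_set_q_01 r : ratio_set_q M r -> 0 <= r <= 1.
Proof. by move=> [rho [sigma [rd sd _ rs ->]]]; exact/ratio_01/rel_ent_q_bounds. Qed.

Lemma rel_ent_q_eta_zeta rho sigma : is_density rho -> is_density sigma ->
  supp_incl_q rho sigma ->
  eta_q M * rel_ent_q rho sigma <= rel_ent_q (M rho) (M sigma)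
    <= zeta_q M * rel_ent_q rho sigma.
Proof.
move=> rd sd rs; have bnd := rel_ent_q_bounds rd sd rs.
have SD : rel_ent_q rho sigma != 0 ->
    ratio_set_q M (rel_ent_q (M rho) (M sigma) / rel_ent_q rho sigma).
  move=> DN0; exists rho, sigma; split => //; apply/eqP => e.
  by move: DN0; rewrite e /rel_ent_q subrr mulmx0 mxtrace0 eqxx.
by rewrite inf_ratio_le ?le_sup_ratio //; exact: ratio_set_q_01.
Qed.
End Quantum.

(** * Coefficients of classical channels and classical data processing *)

Section Classical.
Variables (n m : nat) (Q : 'M[R]_(n, m)).
Hypothesis Qs : col_stochastic Q.

Lemma prob_vec_channel p : prob_vec p -> prob_vec (Q *m p).
Proof.
have [Q0 Q1] := Qs; move=> [p0 p1]; split=> [i|].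
  by rewrite mxE; apply: sumr_ge0 => j _; rewrite mulr_ge0.
under eq_bigr => i _ do rewrite mxE.
rewrite exchange_big /= -[RHS]p1; apply: eq_bigr => j _.
by rewrite -mulr_suml Q1 mul1r.
Qed.

Lemma channel_eq0 p i : prob_vec p -> (Q *m p) i 0 = 0 ->
  forall j, Q i j * p j 0 = 0.
Proof.
have [Q0 _] := Qs; move=> [p0 _] /eqP; rewrite mxE psumr_eq0 => [/allP h j|j _].
  by apply/eqP/h/mem_index_enum.
exact: mulr_ge0.
Qed.

Lemma supp_incl_cl_channel p q : prob_vec p -> prob_vec q -> supp_incl_cl p q ->
  supp_incl_cl (Q *m p) (Q *m q).
Proof.
move=> pp qp pq i; apply: contra_neq => Qq0; rewrite mxE big1 // => j _.
have /eqP := channel_eq0 qp Qq0 j; rewrite mulf_eq0 => /orP[/eqP->|/eqP q0].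
  by rewrite mul0r.
have [->|/pq] := eqVneq (p j 0) 0; first by rewrite mulr0.
by rewrite q0 eqxx.
Qed.

(* Log-sum argument: the weights Q_ij p_j and Q_ij q_j (Qp)_i / (Qq)_i have the same
   sum over j, so [sub_le_mul_ln] applies termwise. *)
Lemma rel_ent_cl_monotone p q : prob_vec p -> prob_vec q -> supp_incl_cl p q ->
  rel_ent_cl (Q *m p) (Q *m q) <= rel_ent_cl p q.
Proof.
move=> pp qp pq; have [Q0 Q1] := Qs; have [p0 p1] := pp; have [q0 q1] := qp.
have [Qp0 Qp1] := prob_vec_channel pp; have [Qq0 Qq1] := prob_vec_channel qp.
set x := Q *m p in Qp0 Qp1 *; set y := Q *m q in Qq0 Qq1 *.
have xy : supp_incl_cl x y by exact: supp_incl_cl_channel.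
rewrite -subr_ge0 /rel_ent_cl.
have -> : \sum_j p j 0 * (ln (p j 0) - ln (q j 0)) =
    \sum_i \sum_j Q i j * p j 0 * (ln (p j 0) - ln (q j 0)).
  rewrite exchange_big; apply: eq_bigr => j _.
  by rewrite -!mulr_suml Q1 mul1r.
rewrite -sumrB.
have -> : \sum_i (\sum_j Q i j * p j 0 * (ln (p j 0) - ln (q j 0))
      - x i 0 * (ln (x i 0) - ln (y i 0)))
  = \sum_i \sum_j Q i j * p j 0 * (ln (p j 0) - ln (q j 0) - (ln (x i 0) - ln (y i 0))).
  apply: eq_bigr => i _.
  rewrite [X in _ - X * _](_ : _ = \sum_j Q i j * p j 0); last by rewrite mxE.
  rewrite mulr_suml -sumrB.
  by apply: eq_bigr => j _; rewrite -mulrBr.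
have {1}<- : \sum_i \sum_j (Q i j * p j 0 - Q i j * q j 0 * (x i 0 / y i 0)) = 0.
  under eq_bigr => i _.
    rewrite sumrB -mulr_suml (_ : \sum_j _ = x i 0) ?[in RHS]mxE //.
    rewrite (_ : \sum_j _ = y i 0) ?[in RHS]mxE //. 
    rewrite mulrCA (_ : x i 0 * _ = x i 0) ?subrr. over.
    have [x0|xN0] := eqVneq (x i 0) 0; first by rewrite x0 mul0r.
    by rewrite divff ?mulr1 // xy.
  by rewrite big1.
apply: ler_sum => i _; apply: ler_sum => j _.
have [->|Qp] := eqVneq (Q i j * p j 0) 0.
  by rewrite mul0r sub0r oppr_le0 !mulr_ge0 // invr_ge0.
have pos (z : R) : 0 <= z -> z != 0 -> 0 < z by rewrite lt0r => -> ->.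
move: (Qp); rewrite mulf_eq0 negb_or => /andP[QN0 pN0].
have xN0 : x i 0 != 0 by apply/eqP => /(channel_eq0 pp)/(_ j)/eqP; apply/negP.
have h1 := pos _ (p0 j) pN0; have h2 := pos _ (q0 j) (pq _ pN0).
have h3 := pos _ (Qp0 i) xN0; have h4 := pos _ (Qq0 i) (xy _ xN0).
have h5 := pos _ (Q0 i j) QN0.
have := @sub_le_mul_ln R (Q i j * p j 0) (Q i j * q j 0 * (x i 0 / y i 0)).
rewrite !lnM ?lnV ?posrE ?mulr_gt0 ?invr_gt0 //.
rewrite !mulr_ge0 ?invr_ge0 // => /(_ isT isT (fun _ => _))h.
apply: (le_trans (h _)); first by rewrite !mulf_neq0 ?invr_neq0 ?lt0r_neq0.
by rewrite ler_wpM2l ?mulr_ge0 //; lra.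
Qed.

(** Gibbs' inequality: the termwise lower bounds [p_i - q_i] sum to 0. *)
Lemma rel_ent_cl_ge0 k (p q : 'cV[R]_k) : prob_vec p -> prob_vec q ->
  supp_incl_cl p q -> 0 <= rel_ent_cl p q.
Proof.
move=> [p0 p1] [q0 q1] pq.
have {1}<- : \sum_i (p i 0 - q i 0) = 0 by rewrite sumrB p1 q1 subrr.
by apply: ler_sum => i _; apply: sub_le_mul_ln => //; exact: pq.
Qed.

Lemma rel_ent_cl_bounds p q : prob_vec p -> prob_vec q -> supp_incl_cl p q ->
  0 <= rel_ent_cl (Q *m p) (Q *m q) <= rel_ent_cl p q.
Proof.
move=> pp qp pq; rewrite rel_ent_cl_monotone // andbT.
by apply: rel_ent_cl_ge0; [exact: prob_vec_channel..|exact: supp_incl_cl_channel].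
Qed.

Lemma ratio_set_cl_01 r : ratio_set_cl Q r -> 0 <= r <= 1.
Proof. by move=> [p [q [pp qp _ pq ->]]]; exact/ratio_01/rel_ent_cl_bounds. Qed.

Lemma rel_ent_cl_eta_zeta p q : prob_vec p -> prob_vec q -> supp_incl_cl p q ->
  eta_cl Q * rel_ent_cl p q <= rel_ent_cl (Q *m p) (Q *m q)
    <= zeta_cl Q * rel_ent_cl p q.
Proof.
move=> pp qp pq; have bnd := rel_ent_cl_bounds pp qp pq.
have SD : rel_ent_cl p q != 0 ->
    ratio_set_cl Q (rel_ent_cl (Q *m p) (Q *m q) / rel_ent_cl p q).
  move=> DN0; exists p, q; split => //; apply/eqP => e.
  by move: DN0; rewrite e /rel_ent_cl big1 ?eqxx // => i _; rewrite subrr mulr0.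
by rewrite inf_ratio_le ?le_sup_ratio //; exact: ratio_set_cl_01.
Qed.
End Classical.
End Ratios.

(** * Jensen gaps *)

Section JensenGap.
Variable R : realType.
Local Notation C := R[i].

Definition jensen_gap (T : Type) (comb : R -> T -> T -> T) (f : T -> R) t x y : R :=
  t * f x + (1 - t) * f y - f (comb t x y).

(** Convexity of [L phi - f] says that its Jensen gap is nonnegative, and the gap is linear in the
    function. A bound on all of [S] suffices since the relative interior lies in [S]. *)
Lemma rel_smooth_gap (T : Type) (comb : R -> T -> T -> T) (S : T -> Prop) f phi L :
  (forall x y t, S x -> S y -> 0 <= t -> t <= 1 ->
     jensen_gap comb f t x y <= L * jensen_gap comb phi t x y) ->
  rel_smooth comb S f phi L.
Proof.
move=> gap x y t [Sx _] [Sy _] t0 t1; rewrite -subr_ge0.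
have := gap x y t Sx Sy t0 t1; rewrite -subr_ge0 /jensen_gap.
by congr (0 <= _); ring.
Qed.

Lemma rel_strongly_convex_gap (T : Type) (comb : R -> T -> T -> T) (S : T -> Prop) f phi mu :
  (forall x y t, S x -> S y -> 0 <= t -> t <= 1 ->
     mu * jensen_gap comb phi t x y <= jensen_gap comb f t x y) ->
  rel_strongly_convex comb S f phi mu.
Proof.
move=> gap x y t [Sx _] [Sy _] t0 t1; rewrite -subr_ge0.
have := gap x y t Sx Sy t0 t1; rewrite -subr_ge0 /jensen_gap.
by congr (0 <= _); ring.
Qed.

Lemma jensen_gap_linear (T : Type) (comb : R -> T -> T -> T) (f g h : T -> R) t x y :
  jensen_gap comb (fun z => - (f z + g z - h z)) t x y =
  jensen_gap comb (fun z => - f z) t x y + jensen_gap comb (fun z => - g z) t x y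
  - jensen_gap comb (fun z => - h z) t x y.
Proof. by rewrite /jensen_gap; ring. Qed.

Lemma sub_affine_gap (t a b c u v : R) :
  t * - (a - u) + (1 - t) * - (b - v) - - (c - (t * u + (1 - t) * v)) =
  t * - a + (1 - t) * - b - - c.
Proof. ring. Qed.

Lemma ler_wpM2l_if (t x y : R) : 0 <= t -> (t != 0 -> x <= y) -> t * x <= t * y.
Proof.
move=> t0 xy; have [->|/xy] := eqVneq t 0; first by rewrite !mul0r.
exact: ler_wpM2l.
Qed.

(** The bounds are asked only at nonzero weight: at [t = 0] the mixture is the other point, whose
    support may fail to contain that of the first. *)
Lemma convex_comb_bounds (e z t a b a' b' : R) : 0 <= t -> 0 <= 1 - t ->
  (t != 0 -> e * a <= a' <= z * a) -> (1 - t != 0 -> e * b <= b' <= z * b) ->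
  e * (t * a + (1 - t) * b) <= t * a' + (1 - t) * b' <= z * (t * a + (1 - t) * b).
Proof.
move=> t0 t1 ha hb; rewrite !mulrDr !(mulrCA _ t) !(mulrCA _ (1 - t)).
apply/andP; split; apply: lerD; apply: ler_wpM2l_if => // tN0.
- by have /andP[] := ha tN0.
- by have /andP[] := hb tN0.
- by have /andP[] := ha tN0.
- by have /andP[] := hb tN0.
Qed.

(** * Jensen gaps of the Shannon entropy *)

Section Shannon.
Variable m : nat.
Implicit Types p q : 'cV[R]_m.

Lemma comb_clE t p q j : comb_cl t p q j 0 = t * p j 0 + (1 - t) * q j 0.
Proof. by rewrite !mxE. Qed.

Lemma comb_cl_sym t p q : comb_cl t p q = comb_cl (1 - t) q p.
Proof. by rewrite /comb_cl subKr addrC. Qed.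

Lemma prob_vec_comb t p q : 0 <= t -> t <= 1 ->
  prob_vec p -> prob_vec q -> prob_vec (comb_cl t p q).
Proof.
move=> t0 t1 [p0 p1] [q0 q1]; have t1' : 0 <= 1 - t by rewrite subr_ge0.
split=> [j|]; first by rewrite comb_clE addr_ge0 // mulr_ge0.
under eq_bigr => j _ do rewrite comb_clE.
by rewrite big_split /= -!mulr_sumr p1 q1; ring.
Qed.

Lemma supp_incl_comb t p q : 0 <= t -> t <= 1 -> prob_vec p -> prob_vec q ->
  t != 0 -> supp_incl_cl p (comb_cl t p q).
Proof.
move=> t0 t1 [p0 _] [q0 _] tN0 j pN0; rewrite comb_clE gt_eqF //.
have t1' : 0 <= 1 - t by rewrite subr_ge0.
rewrite ltr_wpDr ?mulr_ge0 // mulr_gt0 //; first by rewrite lt0r tN0.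
by rewrite lt0r pN0 p0.
Qed.

(** With [z] the mixture, [\sum_j z_j ln z_j] splits linearly in its first factor into the two cross
    terms [\sum_j p_j ln z_j] and [\sum_j q_j ln z_j]. *)
Lemma jensen_gap_shannon t p q :
  jensen_gap (@comb_cl R m) (fun p => - shannon p) t p q =
  t * rel_ent_cl p (comb_cl t p q) + (1 - t) * rel_ent_cl q (comb_cl t p q).
Proof.
rewrite /jensen_gap /shannon /rel_ent_cl !opprK !mulr_sumr -!big_split /= -sumrB.
by apply: eq_bigr => j _; rewrite comb_clE; ring.
Qed.
End Shannon.

(** [Q] sends the mixture [z] to the mixture of the outputs, so the coefficient bounds for the pairs
    [(p, z)] and [(q, z)] are averaged with weights [t] and [1 - t]. *)
Lemma jensen_gap_shannon_channel n m (Q : 'M[R]_(n, m)) t p q :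
  col_stochastic Q -> 0 <= t -> t <= 1 -> prob_vec p -> prob_vec q ->
  eta_cl Q * jensen_gap (@comb_cl R m) (fun p => - shannon p) t p q
  <= jensen_gap (@comb_cl R n) (fun p => - shannon p) t (Q *m p) (Q *m q)
  <= zeta_cl Q * jensen_gap (@comb_cl R m) (fun p => - shannon p) t p q.
Proof.
move=> Qs t0 t1 pp qp; rewrite !jensen_gap_shannon.
have -> : comb_cl t (Q *m p) (Q *m q) = Q *m comb_cl t p q.
  by rewrite /comb_cl mulmxDr -!scalemxAr.
have zp := prob_vec_comb t0 t1 pp qp.
have t1' : 0 <= 1 - t by rewrite subr_ge0.
have hp : t != 0 -> supp_incl_cl p (comb_cl t p q) by exact: supp_incl_comb.
have hq : 1 - t != 0 -> supp_incl_cl q (comb_cl t p q).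
  rewrite comb_cl_sym; apply: supp_incl_comb => //; lra.
set z := comb_cl t p q in zp hp hq *.
apply: convex_comb_bounds => // tN0.
  exact (rel_ent_cl_eta_zeta Qs pp zp (hp tN0)).
exact (rel_ent_cl_eta_zeta Qs qp zp (hq tN0)).
Qed.

(** The logarithm of the quotient splits wherever [p_j Q_ij] is nonzero, and other terms vanish. The
    first summand is linear in [p], so the gap of [- I_c] comes from the output entropy alone. *)
Lemma I_cE n m (Q : 'M[R]_(n, m)) p : col_stochastic Q -> prob_vec p ->
  I_c Q p = \sum_j p j 0 * (\sum_i Q i j * ln (Q i j)) + shannon (Q *m p).
Proof.
move=> Qs pp; have [Q0 _] := Qs; have [p0 _] := pp; have [Qp0 _] := prob_vec_channel Qs pp.
have -> : shannon (Q *m p) = \sum_j \sum_i - (p j 0 * Q i j * ln ((Q *m p) i 0)).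
  rewrite exchange_big /shannon -sumrN; apply: eq_bigr => i _.
  by rewrite sumrN -mulr_suml mxE; congr (- (_ * _)); apply: eq_bigr => j _; rewrite mulrC.
rewrite -big_split; apply: eq_bigr => j _ /=; rewrite mulr_sumr -big_split.
apply: eq_bigr => i _ /=; rewrite mulrA -mulrBr.
have -> : \sum_k p k 0 * Q i k = (Q *m p) i 0.
  by rewrite mxE; apply: eq_bigr => k _; rewrite mulrC.
have [->|pQ] := eqVneq (p j 0 * Q i j) 0; first by rewrite !mul0r.
have xN0 : (Q *m p) i 0 != 0.
  by apply/eqP => /(channel_eq0 Qs pp)/(_ j)/eqP; rewrite mulrC; apply/negP.
move: pQ; rewrite mulf_eq0 negb_or => /andP[_ QN0].
rewrite ln_div ?posrE // lt0r ?QN0 ?xN0 /=; [exact: Q0|exact: Qp0].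
Qed.

Lemma jensen_gap_I_c n m (Q : 'M[R]_(n, m)) t p q : col_stochastic Q ->
  0 <= t -> t <= 1 -> prob_vec p -> prob_vec q ->
  jensen_gap (@comb_cl R m) (fun p => - I_c Q p) t p q
  = jensen_gap (@comb_cl R n) (fun p => - shannon p) t (Q *m p) (Q *m q).
Proof.
move=> Qs t0 t1 pp qp; rewrite /jensen_gap !I_cE //; last exact: prob_vec_comb.
have -> : comb_cl t (Q *m p) (Q *m q) = Q *m comb_cl t p q.
  by rewrite /comb_cl mulmxDr -!scalemxAr.
have -> : \sum_j comb_cl t p q j 0 * (\sum_i Q i j * ln (Q i j)) =
    t * (\sum_j p j 0 * (\sum_i Q i j * ln (Q i j)))
    + (1 - t) * (\sum_j q j 0 * (\sum_i Q i j * ln (Q i j))).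
  rewrite !mulr_sumr -big_split; apply: eq_bigr => j _.
  by rewrite comb_clE /=; ring.
ring.
Qed.

(** * Jensen gaps of the von Neumann entropy *)

Section VonNeumann.
Variable d : nat.
Implicit Types x y : 'M[C]_d.

Lemma comb_q_sym t x y : comb_q t x y = comb_q (1 - t) y x.
Proof. by rewrite /comb_q subKr addrC. Qed.

Lemma density_comb t x y : 0 <= t -> t <= 1 ->
  is_density x -> is_density y -> is_density (comb_q t x y).
Proof.
move=> t0 t1 [xp x1] [yp y1]; have t1' : 0 <= 1 - t by rewrite subr_ge0.
split; first by apply: is_psdD; apply: is_psdZ.
by rewrite raddfD /= !linearZ /= x1 y1 !mulr1 /embC -rmorphD /= subrKC.
Qed.

(** On the kernel of the mixture two nonnegative forms add up to 0, so the form of [x], which has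
    weight [t != 0], vanishes there. *)
Lemma supp_incl_comb_q t x y : 0 <= t -> t <= 1 -> is_density x -> is_density y ->
  t != 0 -> supp_incl_q x (comb_q t x y).
Proof.
move=> t0 t1 [xp _] [yp _] tN0 v zv0; have t1' : 0 <= 1 - t by rewrite subr_ge0.
apply: (psd_quad_form_eq0 xp).
have := congr1 (fun u => (v^H *m u) 0 0) zv0.
rewrite mulmx0 [RHS]mxE mulmxA mulmxDr mulmxDl mxE => /eqP.
rewrite paddr_eq0 ?is_psdZ // => /andP[/eqP + _].
rewrite -scalemxAr -scalemxAl mxE => /eqP; rewrite mulf_eq0 => /orP[|/eqP//].
by move=> /eqP/complexI/eqP; rewrite (negbTE tN0).
Qed.

Lemma rel_ent_q_vN_entropy x y :
  rel_ent_q x y = - vN_entropy x - complex.Re (\tr (x *m mxlog y)).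
Proof. by rewrite /rel_ent_q mulmxBr raddfB /= ReD ReN /vN_entropy opprK. Qed.

Lemma jensen_gap_vN_entropy t x y :
  jensen_gap (@comb_q R d) (fun x => - vN_entropy x) t x y =
  t * rel_ent_q x (comb_q t x y) + (1 - t) * rel_ent_q y (comb_q t x y).
Proof.
rewrite /jensen_gap; move zE : (comb_q t x y) => z; rewrite !rel_ent_q_vN_entropy.
have -> : vN_entropy z = - (t * complex.Re (\tr (x *m mxlog z))
    + (1 - t) * complex.Re (\tr (y *m mxlog z))).
  rewrite [LHS]/vN_entropy; congr (- _).
  rewrite -[X in X *m _]zE /comb_q mulmxDl -!scalemxAl linearD !linearZ /=.
  by rewrite ReD ![embC _ * _]mulrC !Re_mulr_embC ![_ * t]mulrC [_ * (1 - t)]mulrC.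
move: (vN_entropy x) (vN_entropy y) => a b.
move: (complex.Re _) (complex.Re _) => c e; ring.
Qed.
End VonNeumann.

Lemma channel_comb a b (M : 'M[C]_a -> 'M[C]_b) t x y :
  is_linear_map M -> M (comb_q t x y) = comb_q t (M x) (M y).
Proof.
move=> Ml; have M0 : M 0 = 0.
  by have := Ml (-1) 0 0; rewrite scaler0 addr0 scaleN1r addNr.
have MZ c X : M (c *: X) = c *: M X by rewrite -[c *: X]addr0 Ml M0 addr0.
by rewrite /comb_q Ml MZ.
Qed.

Lemma jensen_gap_vN_channel a b (M : 'M[C]_a -> 'M[C]_b) t x y :
  cptp M -> 0 <= t -> t <= 1 -> is_density x -> is_density y ->
  eta_q M * jensen_gap (@comb_q R a) (fun x => - vN_entropy x) t x y
  <= jensen_gap (@comb_q R a) (fun x => - vN_entropy (M x)) t x y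
  <= zeta_q M * jensen_gap (@comb_q R a) (fun x => - vN_entropy x) t x y.
Proof.
move=> Mc t0 t1 xd yd; have [Ml _ _] := Mc.
have -> : jensen_gap (@comb_q R a) (fun x => - vN_entropy (M x)) t x y =
    jensen_gap (@comb_q R b) (fun x => - vN_entropy x) t (M x) (M y).
  by rewrite /jensen_gap channel_comb.
rewrite !jensen_gap_vN_entropy -channel_comb //.
have zd := density_comb t0 t1 xd yd.
have t1' : 0 <= 1 - t by rewrite subr_ge0.
have hx : t != 0 -> supp_incl_q x (comb_q t x y) by exact: supp_incl_comb_q.
have hy : 1 - t != 0 -> supp_incl_q y (comb_q t x y).
  rewrite comb_q_sym; apply: supp_incl_comb_q => //; lra.
set z := comb_q t x y in zd hx hy *.
apply: convex_comb_bounds => // tN0.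
  exact (rel_ent_q_eta_zeta Mc xd zd (hx tN0)).
exact (rel_ent_q_eta_zeta Mc yd zd (hy tN0)).
Qed.

(** Independence of the decomposition picked by [epsilon]: [V = W^H U] intertwines the two diagonal
    matrices, so [k_i = l_j] wherever [V i j] is nonzero, and [V] then also intertwines their images
    under [f]. *)
Lemma mxfun_spectral d (f : R -> R) (A U : 'M[C]_d) l : is_spectral A U l ->
  mxfun f A = U *m diag_mx (map_mx (fun x => embC (f x)) l) *m U^H.
Proof.
move=> As; have [Uu AE] := As.
have AH : A^H = A.
  rewrite AE !mx_adjM mx_adjK mulmxA; congr (_ *m _ *m _).
  apply/matrixP => i j; rewrite mx_adjE !mxE eq_sym.
  by case: eqVneq => [->|_]; rewrite ?mulr1n ?mulr0n ?conjc0 //; exact: conjc_real.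
have As' := spec_pairP AH; have [Wu AE'] := As'.
rewrite /mxfun; move: (spec_pair A) As' Wu AE' => [W k] /= As' Wu AE'.
pose V := W^H *m U.
have VE : diag_mx (map_mx (@embC R) k) *m V = V *m diag_mx (map_mx (@embC R) l).
  rewrite -(is_spectral_conj As) -(is_spectral_conj As') /V.
  by rewrite !mulmxA -(mulmxA _ W) Wu mulmx1 -(mulmxA _ U) Uu mulmx1.
have VfE : diag_mx (map_mx (fun x => embC (f x)) k) *m V
    = V *m diag_mx (map_mx (fun x => embC (f x)) l).
  apply/matrixP => i j; move/matrixP/(_ i j): VE.
  rewrite !mul_diag_mx !mul_mx_diag [LHS]mxE [RHS]mxE [X in X * _]mxE [X in _ = _ * X]mxE.
  move=> VE; rewrite [LHS]mxE [RHS]mxE [X in X * _]mxE [X in _ = _ * X]mxE.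
  have [->|VN0] := eqVneq (V i j) 0; first by rewrite mulr0 mul0r.
  move: VE; rewrite mulrC => /(mulfI VN0)/complexI ->; exact: mulrC.
have UE : U = W *m V by rewrite /V mulmxA Wu mul1mx.
have UfE : U *m diag_mx (map_mx (fun x => embC (f x)) l) =
    W *m diag_mx (map_mx (fun x => embC (f x)) k) *m V.
  by rewrite {1}UE -[LHS]mulmxA -VfE mulmxA.
by rewrite UfE /V -!mulmxA Uu mulmx1.
Qed.

(** * Probability vectors as diagonal states, and the Holevo quantity *)

Definition diag_state m (p : 'cV[R]_m) : 'M[C]_m :=
  \sum_j embC (p j 0) *: ketbra R j.

Lemma diag_stateE m (p : 'cV[R]_m) : diag_state p = diag_mx (map_mx (@embC R) p^T).
Proof.
apply/matrixP => i j; rewrite summxE (bigD1 i) //= big1 ?addr0 => [|k ki].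
  by rewrite !mxE eqxx eq_sym mulr_natr.
by rewrite !mxE eq_sym (negbTE ki) mulr0.
Qed.

Lemma is_spectral_diag_state m (p : 'cV[R]_m) : is_spectral (diag_state p) 1%:M p^T.
Proof.
split; first by rewrite /is_unitary mx_adj1 mulmx1.
by rewrite mx_adj1 mulmx1 mul1mx diag_stateE.
Qed.

Lemma density_diag_state m (p : 'cV[R]_m) : prob_vec p -> is_density (diag_state p).
Proof.
move=> [p0 p1]; split=> [v|].
  rewrite diag_stateE quad_form_diag ler0c; apply: sumr_ge0 => j _.
  by rewrite mulr_ge0 ?sqmod_ge0 // mxE.
rewrite diag_stateE mxtrace_diag -[RHS](rmorph1 (real_complex R)) -p1 rmorph_sum.
by apply: eq_bigr => j _; rewrite !mxE.
Qed.

Lemma vN_entropy_diag_state m (p : 'cV[R]_m) : vN_entropy (diag_state p) = shannon p.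
Proof.
rewrite /vN_entropy /shannon /mxlog (mxfun_spectral _ (is_spectral_diag_state p)).
rewrite mxtrace_mul_conj_diag Re_sum; congr (- _); apply: eq_bigr => j _.
rewrite mx_adj1 mulmx1 mul1mx [X in _ * X]mxE Re_mulr_embC diag_stateE !mxE eqxx.
by rewrite mulr1n.
Qed.

Lemma diag_state_comb m t (p q : 'cV[R]_m) :
  diag_state (comb_cl t p q) = comb_q t (diag_state p) (diag_state q).
Proof.
rewrite /diag_state /comb_q !scaler_sumr -big_split; apply: eq_bigr => j _.
by rewrite comb_clE /= !scalerA -scalerDl /embC !(rmorphD, rmorphM).
Qed.

Lemma holevoE m a b (N : 'M[C]_a -> 'M[C]_b) (E : 'M[C]_m -> 'M[C]_a) p :
  is_linear_map E -> holevo N E p =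
  vN_entropy (N (E (diag_state p))) - \sum_j p j 0 * vN_entropy (N (E (ketbra R j))).
Proof.
move=> El; have E0 : E 0 = 0.
  by have := El (-1) 0 0; rewrite scaler0 addr0 scaleN1r addNr.
have EE : \sum_j embC (p j 0) *: E (ketbra R j) = E (diag_state p).
  rewrite /diag_state.
  by elim: (index_enum _) => [|j r IH]; rewrite ?big_nil // !big_cons El IH.
by rewrite /holevo EE.
Qed.

(** The average of the entropies [S(N(E(|j><j|)))] is linear in [p] and drops out of the gap,
    leaving an output entropy evaluated on diagonal states. *)
Lemma jensen_gap_holevo m a b (N : 'M[C]_a -> 'M[C]_b) (E : 'M[C]_m -> 'M[C]_a) t p q :
  is_linear_map E ->
  jensen_gap (@comb_cl R m) (fun p => - holevo N E p) t p q =
  jensen_gap (@comb_q R m) (fun x => - vN_entropy (N (E x))) t (diag_state p) (diag_state q).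
Proof.
move=> El; rewrite /jensen_gap !holevoE // diag_state_comb.
have -> : \sum_j comb_cl t p q j 0 * vN_entropy (N (E (ketbra R j))) =
    t * (\sum_j p j 0 * vN_entropy (N (E (ketbra R j))))
    + (1 - t) * (\sum_j q j 0 * vN_entropy (N (E (ketbra R j)))).
  rewrite !mulr_sumr -big_split; apply: eq_bigr => j _.
  by rewrite comb_clE /=; ring.
exact: sub_affine_gap.
Qed.

Lemma jensen_gap_diag_state m t (p q : 'cV[R]_m) :
  jensen_gap (@comb_q R m) (fun x => - vN_entropy x) t (diag_state p) (diag_state q)
  = jensen_gap (@comb_cl R m) (fun p => - shannon p) t p q.
Proof. by rewrite /jensen_gap -diag_state_comb !vN_entropy_diag_state. Qed.

Lemma jensen_gap_I_q a b e (N : 'M[C]_a -> 'M[C]_b) (Nc : 'M[C]_a -> 'M[C]_e) t x y :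
  jensen_gap (@comb_q R a) (fun x => - I_q N Nc x) t x y =
  jensen_gap (@comb_q R a) (fun x => - vN_entropy x) t x y
  + jensen_gap (@comb_q R a) (fun x => - vN_entropy (N x)) t x y
  - jensen_gap (@comb_q R a) (fun x => - vN_entropy (Nc x)) t x y.
Proof. exact: jensen_gap_linear. Qed.
End JensenGap.

(** * Relative smoothness and strong convexity of the three information quantities *)

Unset Implicit Arguments.
Theorem mainTheorem7 (R : realType) (n m dA dB : nat)
  (Q : 'M[R]_(n, m))
  (N : 'M[R[i]]_dA -> 'M[R[i]]_dB)
  (E : 'M[R[i]]_m -> 'M[R[i]]_dA) :
  col_stochastic Q -> cptp N -> cptp E ->
  (* (a) *)
  (rel_smooth (@comb_cl R m) (@prob_vec R m)
      (fun p => - I_c Q p) (fun p => - shannon p) (zeta_cl Q)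
   /\ rel_strongly_convex (@comb_cl R m) (@prob_vec R m)
      (fun p => - I_c Q p) (fun p => - shannon p) (eta_cl Q))
  /\
  (* (b) *)
  (rel_smooth (@comb_cl R m) (@prob_vec R m)
      (fun p => - holevo N E p) (fun p => - shannon p) (zeta_q (fun X => N (E X)))
   /\ rel_strongly_convex (@comb_cl R m) (@prob_vec R m)
      (fun p => - holevo N E p) (fun p => - shannon p) (eta_q (fun X => N (E X))))
  /\
  (* (c) for any Stinespring is_isometry V of N, with complementary channel N_c *)
  (forall (dE : nat) (V : 'M[R[i]]_(dB * dE, dA)),
     is_isometry V ->
     (forall X : 'M[R[i]]_dA, N X = ptrace_E (V *m X *m mx_adj V)) ->
     rel_smooth (@comb_q R dA) (@is_density R dA)
       (fun rho => - I_q N (compl_channel V) rho) (fun rho => - vN_entropy rho)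
       (1 + zeta_q N - eta_q (compl_channel V))
     /\ rel_strongly_convex (@comb_q R dA) (@is_density R dA)
       (fun rho => - I_q N (compl_channel V) rho) (fun rho => - vN_entropy rho)
       (1 + eta_q N - zeta_q (compl_channel V))).
Proof.
move=> Qs Nc Ec; split; [|split].
- split; [apply: rel_smooth_gap|apply: rel_strongly_convex_gap] => p q t pp qp t0 t1;
    rewrite jensen_gap_I_c //;
    by have /andP[] := jensen_gap_shannon_channel Qs t0 t1 pp qp.
- have [El _ _] := Ec; have NEc := cptp_comp Ec Nc.
  (* The composite of [E] and [N] is itself a channel; on diagonal states its von Neumann reference
     gap is the Shannon gap. *)
  split; [apply: rel_smooth_gap|apply: rel_strongly_convex_gap] => p q t pp qp t0 t1;
    rewrite (jensen_gap_holevo _ _ _ _ El) -jensen_gap_diag_state;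
    by have /andP[] := jensen_gap_vN_channel NEc t0 t1
      (density_diag_state pp) (density_diag_state qp).
- move=> dE V Viso NE; have Cc := compl_channel_cptp Viso.
  (* The gap of the complementary channel enters with a minus sign: smoothness pairs [zeta_q N] with
     the [eta_q] of the complement, and strong convexity pairs [eta_q N] with its [zeta_q]. The term
     [S(rho)] contributes the constant 1. *)
  split; [apply: rel_smooth_gap|apply: rel_strongly_convex_gap] => x y t xd yd t0 t1;
    rewrite jensen_gap_I_q;
    have /andP[] := jensen_gap_vN_channel Nc t0 t1 xd yd;
    have /andP[] := jensen_gap_vN_channel Cc t0 t1 xd yd;
    move: (zeta_q N) (eta_q N) (zeta_q (compl_channel V)) (eta_q (compl_channel V));
    by move=> zN eN zV eV; rewrite !mulrBl !mulrDl !mul1r; lra.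
Qed.
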